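(* Let $\mathcal{R}$ be an o-minimal expansion of the ordered field of real numbers $\mathbb{R}$ and let $D\subseteq\mathbb{R}$ be discrete. Then either $(\mathcal{R},D)$ defines $\mathbb{Z}$, or every subset of $\mathbb{R}$ definable in $(\mathcal{R},D)$ has nonempty interior or is nowhere dense.
   Context: $(\mathcal{R},D)$ denotes the expansion of $\mathcal{R}$ by a unary predicate for $D$. Definable means definable with parameters. A set is discrete if each of its points is isolated. *)

(* Defs.v *)
From HB Require Import structures.
From mathcomp Require Import all_boot all_order all_algebra.
From mathcomp Require Import all_classical all_reals all_analysis.
Set Implicit Arguments.
Unset Strict Implicit.
Unset Printing Implicit Defensive.
Import Order.TTheory GRing.Theory Num.Theory.
Import numFieldNormedType.Exports.
Local Open Scope classical_set_scope.
Local Open Scope ring_scope.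

(* One-sorted first-order logic with equality; constants are 0-ary function
   symbols, and there is no restriction on the number of symbols. *)
Record language : Type := Language {
  fun_symbol : Type;
  fun_arity : fun_symbol -> nat;
  rel_symbol : Type;
  rel_arity : rel_symbol -> nat }.

Record structure (L : language) (M : Type) : Type := Structure {
  fun_interp : forall f : fun_symbol L, ('I_(fun_arity f) -> M) -> M;
  rel_interp : forall r : rel_symbol L, ('I_(rel_arity r) -> M) -> Prop }.

(* Variables are de Bruijn indices: under a quantifier, [Var 0] is the bound
   variable and [Var n.+1] is the variable n of the enclosing context. *)
Inductive term (L : language) : Type :=
| Var of nat
| App (f : fun_symbol L) of ('I_(fun_arity f) -> term L).

Inductive formula (L : language) : Type :=
| FFalse
| FEq of term L & term L
| FRel (r : rel_symbol L) of ('I_(rel_arity r) -> term L)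
| FImp of formula L & formula L
| FAnd of formula L & formula L
| FOr of formula L & formula L
| FForall of formula L
| FExists of formula L.

Definition env_cons (M : Type) (a : M) (e : nat -> M) : nat -> M :=
  fun n => if n is k.+1 then e k else a.

Section Semantics.
Variables (L : language) (M : Type) (S : structure L M).

Fixpoint eval (e : nat -> M) (t : term L) : M :=
  match t with
  | Var n => e n
  | App f ts => fun_interp S (fun i => eval e (ts i))
  end.

Fixpoint sat (e : nat -> M) (p : formula L) : Prop :=
  match p with
  | FFalse => False
  | FEq t u => eval e t = eval e u
  | FRel r ts => rel_interp S (fun i => eval e (ts i))
  | FImp p q => sat e p -> sat e q
  | FAnd p q => sat e p /\ sat e q
  | FOr p q => sat e p \/ sat e q
  | FForall p => forall a : M, sat (env_cons a e) p
  | FExists p => exists a : M, sat (env_cons a e) p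
  end.

(* Definability with parameters, for subsets of the universe: the environment e
   assigns the parameters to the free variables other than [Var 0]. *)
Definition definable (A : set M) : Prop :=
  exists (p : formula L) (e : nat -> M), A = [set x | sat (env_cons x e) p].

End Semantics.

Definition language_sum (L1 L2 : language) : language := {|
  fun_symbol := fun_symbol L1 + fun_symbol L2;
  fun_arity f := match f with inl g => fun_arity g | inr g => fun_arity g end;
  rel_symbol := rel_symbol L1 + rel_symbol L2;
  rel_arity r := match r with inl s => rel_arity s | inr s => rel_arity s end |}.

(* The expansion of S1 by the symbols of a disjoint language L2, interpreted
   as in S2. Up to renaming symbols, every expansion of S1 has this form. *)
Definition expansion (L1 L2 : language) (M : Type)
    (S1 : structure L1 M) (S2 : structure L2 M) :
    structure (language_sum L1 L2) M := {|
  fun_interp f :=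
    match f return ('I_(@fun_arity (language_sum L1 L2) f) -> M) -> M with
    | inl g => @fun_interp _ _ S1 g
    | inr g => @fun_interp _ _ S2 g
    end;
  rel_interp r :=
    match r return ('I_(@rel_arity (language_sum L1 L2) r) -> M) -> Prop with
    | inl s => @rel_interp _ _ S1 s
    | inr s => @rel_interp _ _ S2 s
    end |}.

Definition unary_predicate_language : language := {|
  fun_symbol := void;
  fun_arity _ := 0%N;
  rel_symbol := unit;
  rel_arity _ := 1%N |}.

Definition unary_predicate_structure (M : Type) (D : set M) :
    structure unary_predicate_language M :=
  @Structure unary_predicate_language M
    (fun f : void => match f with end)
    (fun (_ : unit) (v : 'I_1 -> M) => D (v ord0)).

Definition expand_by_set (L : language) (M : Type) (S : structure L M)
    (D : set M) : structure (language_sum L unary_predicate_language) M :=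
  expansion S (unary_predicate_structure D).

Inductive ordered_ring_fun : Type := OZero | OOne | OOpp | OAdd | OMul.
Inductive ordered_ring_rel : Type := OLt.

Definition ordered_ring_language : language := {|
  fun_symbol := ordered_ring_fun;
  fun_arity f :=
    (match f with OZero | OOne => 0 | OOpp => 1 | OAdd | OMul => 2 end)%N;
  rel_symbol := ordered_ring_rel;
  rel_arity _ := 2%N |}.

Section OrderedField.
Variable R : realType.

Definition ordered_field : structure ordered_ring_language R := {|
  fun_interp f :=
    match f return ('I_(@fun_arity ordered_ring_language f) -> R) -> R with
    | OZero => fun _ => 0
    | OOne => fun _ => 1
    | OOpp => fun v => - v ord0
    | OAdd => fun v => v ord0 + v ord_max
    | OMul => fun v => v ord0 * v ord_max
    end;
  rel_interp _ := fun v : 'I_2 -> R => v ord0 < v ord_max |}.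

Definition o_minimal (L : language) (S : structure L R) : Prop :=
  forall A : set R, definable S A ->
    exists (points : seq R) (intervals : seq (\bar R * \bar R)),
      A = [set` points] `|`
          \bigcup_(ab in [set` intervals])
            [set x : R | (ab.1 < x%:E)%E /\ (x%:E < ab.2)%E].

End OrderedField.

Definition discrete_subset (T : topologicalType) (D : set T) : Prop :=
  forall x, D x -> isolated D x.

Definition nowhere_dense (T : topologicalType) (A : set T) : Prop :=
  interior (closure A) = set0.

(* Main.v *)
(* Write S for the o-minimal structure and RD for its expansion by D.

   Traces. Call theta-trace of a tuple x of reals the set of tuples d of elements
   of D such that theta(d, x), for a relation theta definable in S. If D is
   infinite, every relation definable in RD is determined by the trace of a
   single theta. To treat a quantifier over a, one looks at the jumps of
   theta(d, . x), for all d in D: by uniform finiteness, boundedly many for each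
   d, so that finitely many traces of x describe their ordering, together with
   their mutual distances measured by arbitrarily small reals obtained from D.
   This decides which cuts among the jumps are realized by a real number. No
   tameness of D is needed here.

   Uniform finiteness goes by induction on the number of parameters. For a planar
   definable family with finite fibres, stability (a first-order condition
   implying that the cardinality of the fibre is locally constant) holds outside
   a countable set, hence outside a finite one; it is then enough to bound the
   fibres over one sample point in each interval between unstable points.

   Hence a set A definable in RD is constant on each interval avoiding the set F of
   the jumps of theta(d, .) for d in D. As D is discrete, F is an increasing union
   of a definable family of finite sets. If F is nowhere dense, we are done.

   If F is dense in an interval, list F in order of appearance and let gap v be
   the distance from v to the previous points. Say that c selects v if
   0 < v - c < eps * gap v, with label (v - c) / (eps * gap v) in ]0, 1[. For small
   eps, every finite sequence of labels can be approximated by suitable choices of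
   c and of a segment of the list. So arbitrary finite sets are uniformly coded up
   to small errors, in particular those of the form {1, ..., n + 1}, which makes
   the set of natural numbers definable. *)
Require Import Defs.
From mathcomp Require Import all_boot all_order all_algebra.
From mathcomp Require Import all_classical all_reals all_analysis.
From mathcomp Require Import ring lra.
Set Implicit Arguments.
Unset Strict Implicit.
Unset Printing Implicit Defensive.
Import Order.TTheory GRing.Theory Num.Theory.
Import numFieldNormedType.Exports.
Local Open Scope classical_set_scope.
Local Open Scope ring_scope.

(** * Renaming of variables, and formulas as functions of finitely many variables *)

Section Renaming.
Variable L : language.

Fixpoint rename_term (rho : nat -> nat) (t : term L) : term L :=
  match t with
  | Var n => @Var L (rho n)
  | App f ts => App (fun i => rename_term rho (ts i))
  end.

Definition lift_renaming (rho : nat -> nat) (n : nat) : nat :=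
  if n is k.+1 then (rho k).+1 else 0%N.

Fixpoint rename (rho : nat -> nat) (p : formula L) : formula L :=
  match p with
  | FFalse => @FFalse L
  | FEq t u => FEq (rename_term rho t) (rename_term rho u)
  | FRel r ts => FRel (fun i => rename_term rho (ts i))
  | FImp p q => FImp (rename rho p) (rename rho q)
  | FAnd p q => FAnd (rename rho p) (rename rho q)
  | FOr p q => FOr (rename rho p) (rename rho q)
  | FForall p => FForall (rename (lift_renaming rho) p)
  | FExists p => FExists (rename (lift_renaming rho) p)
  end.

Variables (M : Type) (S : structure L M).

Lemma eval_rename rho e t :
  Defs.eval S e (rename_term rho t) = Defs.eval S (e \o rho) t.
Proof. by elim: t => //= f ts IH; congr fun_interp; apply: funext. Qed.

Lemma env_cons_lift (a : M) e rho :
  env_cons a e \o lift_renaming rho = env_cons a (e \o rho).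
Proof. by apply: funext => -[|n]. Qed.

Lemma sat_rename rho e p : sat S e (rename rho p) <-> sat S (e \o rho) p.
Proof.
elim: p rho e => //=.
- by move=> t u rho e; rewrite !eval_rename.
- move=> r ts rho e; rewrite (_ : (fun i => _) = (fun i => Defs.eval S (e \o rho) (ts i))) //.
  by apply: funext => i; rewrite eval_rename.
- by move=> p IHp q IHq rho e; rewrite IHp IHq.
- by move=> p IHp q IHq rho e; rewrite IHp IHq.
- by move=> p IHp q IHq rho e; rewrite IHp IHq.
- move=> p IH rho e; split=> H a; move: (H a).
    by rewrite IH env_cons_lift.
  by rewrite IH env_cons_lift.
- move=> p IH rho e; split=> -[a H]; exists a; move: H.
    by rewrite IH env_cons_lift.
  by rewrite IH env_cons_lift.
Qed.

Lemma eval_finite_support (t : term L) : exists B : nat,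
  forall e e', (forall k, (k < B)%N -> e k = e' k) -> Defs.eval S e t = Defs.eval S e' t.
Proof.
elim: t => [n|f ts /= /choice[B HB]].
  by exists n.+1 => e e' /= ->.
exists (\max_i B i) => e e' H; congr fun_interp; apply: funext => i.
by apply: HB => k kB; apply: H; exact: leq_trans (leq_bigmax i).
Qed.

(** Environments are infinite sequences; this bound is what later permits an induction on the number
    of parameters and a reduction from sequences to tuples. *)
Lemma sat_finite_support (p : formula L) : exists B : nat,
  forall e e', (forall k, (k < B)%N -> e k = e' k) -> sat S e p <-> sat S e' p.
Proof.
have binary B1 B2 (e e' : nat -> M) :
    (forall k, (k < maxn B1 B2)%N -> e k = e' k) ->
    (forall k, (k < B1)%N -> e k = e' k) /\ (forall k, (k < B2)%N -> e k = e' k).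
  by move=> H; split=> k kB; apply: H; rewrite leq_max kB ?orbT.
have under_quantifier B (e e' : nat -> M) : (forall k, (k < B)%N -> e k = e' k) ->
    forall a k, (k < B)%N -> env_cons a e k = env_cons a e' k.
  by move=> H a [|k] //= kB; apply: H; exact: ltn_trans kB.
elim: p => /=.
- by exists 0%N.
- move=> t u; have [B1 H1] := eval_finite_support t.
  have [B2 H2] := eval_finite_support u; exists (maxn B1 B2) => e e' /binary[h1 h2].
  by rewrite (H1 e e') // (H2 e e').
- move=> r ts; have /choice[B HB] := fun i => eval_finite_support (ts i).
  exists (\max_i B i) => e e' H.
  rewrite (_ : (fun i => _) = (fun i => Defs.eval S e' (ts i))) //.
  apply: funext => i; apply: HB => k kB; apply: H.
  exact: leq_trans (leq_bigmax i).
- move=> p [B1 H1] q [B2 H2]; exists (maxn B1 B2) => e e' /binary[h1 h2].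
  by rewrite (H1 e e') // (H2 e e').
- move=> p [B1 H1] q [B2 H2]; exists (maxn B1 B2) => e e' /binary[h1 h2].
  by rewrite (H1 e e') // (H2 e e').
- move=> p [B1 H1] q [B2 H2]; exists (maxn B1 B2) => e e' /binary[h1 h2].
  by rewrite (H1 e e') // (H2 e e').
- move=> p [B HB]; exists B => e e' H; split=> + a => /(_ a).
    by rewrite (HB _ (env_cons a e')) //; exact: under_quantifier.
  by rewrite (HB _ (env_cons a e')) //; exact: under_quantifier.
- move=> p [B HB]; exists B => e e' H; split=> -[a Ha]; exists a; move: Ha.
    by rewrite (HB _ (env_cons a e')) //; exact: under_quantifier.
  by rewrite (HB _ (env_cons a e')) //; exact: under_quantifier.
Qed.

End Renaming.

(** * Closure properties of definable predicates and functions *)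

Definition opt_cons (V M : Type) (a : M) (e : V -> M) : option V -> M :=
  fun o => if o is Some i then e i else a.

Section DefinablePredicates.
Variables (L : language) (M : Type) (S : structure L M) (m0 : M).

Definition assign (V : Type) (v : nat -> V + M) (e : V -> M) (k : nat) : M :=
  match v k with inl i => e i | inr c => c end.

(* Relations are predicates on valuations of an arbitrary type V of variables,
   so that contexts may be built with option, sums and products; each variable
   of the formula stands for an element of V or for a parameter. *)
Definition defPred (V : Type) (P : (V -> M) -> Prop) : Prop :=
  exists (p : formula L) (v : nat -> V + M), forall e, P e <-> sat S (assign v e) p.

Definition defFun (V : Type) (f : (V -> M) -> M) : Prop :=
  defPred (fun e : option V -> M => e None = f (fun i => e (Some i))).

Definition defSet (A : M -> Prop) : Prop :=
  defPred (fun e : unit -> M => A (e tt)).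

Definition defRel (T : M -> M -> Prop) : Prop :=
  defPred (fun e : bool -> M => T (e true) (e false)).

Lemma defPred_iff (V : Type) (P Q : (V -> M) -> Prop) :
  (forall e, P e <-> Q e) -> defPred P -> defPred Q.
Proof. by move=> PQ [p [v Pp]]; exists p, v => e; rewrite -PQ. Qed.

Lemma definableP (A : set M) : definable S A <-> defSet A.
Proof.
split=> [[p [e0 ->]]|[p [v Hp]]].
  exists p, (fun k => if k is k'.+1 then inr (e0 k') else inl tt) => e /=.
  rewrite (_ : assign _ e = env_cons (e tt) e0) //.
  by apply: funext => -[].
exists (rename (fun k => if v k is inl _ then 0%N else k.+1) p).
exists (fun k => if v k is inr c then c else m0).
apply/predeqP => x /=; rewrite sat_rename.
apply: iff_trans (Hp (fun _ => x)) _.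
rewrite (_ : assign v _ = env_cons x (fun k => if v k is inr c then c else m0)
  \o (fun k => if v k is inl _ then 0%N else k.+1)) //.
by apply: funext => k; rewrite /assign /=; case Ek: (v k) => //=; rewrite Ek.
Qed.

Lemma defPred_binary (V : Type) (P Q : (V -> M) -> Prop)
    (op : formula L -> formula L -> formula L) (sop : Prop -> Prop -> Prop) :
  (forall e p q, sat S e (op p q) = sop (sat S e p) (sat S e q)) ->
  (forall A A' B B', (A <-> A') -> (B <-> B') -> sop A B <-> sop A' B') ->
  defPred P -> defPred Q -> defPred (fun e => sop (P e) (Q e)).
Proof.
move=> Hop Hsop [p [v Hp]] [q [w Hq]].
(* The variables of [p] go to the even indices and those of [q] to the odd ones, so that one
   assignment serves both. *)
exists (op (rename double p) (rename (fun n => n.*2.+1) q)).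
exists (fun k => if odd k then w k./2 else v k./2) => e.
rewrite Hop; apply: Hsop; rewrite sat_rename ?Hp ?Hq.
  rewrite (_ : assign _ e \o double = assign v e) //.
  by apply: funext => k; rewrite /assign /= odd_double doubleK.
rewrite (_ : assign _ e \o _ = assign w e) //.
by apply: funext => k; rewrite /assign /= odd_double /= uphalf_double.
Qed.

Lemma defPred_and (V : Type) (P Q : (V -> M) -> Prop) :
  defPred P -> defPred Q -> defPred (fun e => P e /\ Q e).
Proof.
apply: (@defPred_binary _ _ _ (@FAnd L) and) => //.
by move=> A A' B B' -> ->.
Qed.

Lemma defPred_or (V : Type) (P Q : (V -> M) -> Prop) :
  defPred P -> defPred Q -> defPred (fun e => P e \/ Q e).
Proof.
apply: (@defPred_binary _ _ _ (@FOr L) or) => //.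
by move=> A A' B B' -> ->.
Qed.

Lemma defPred_imp (V : Type) (P Q : (V -> M) -> Prop) :
  defPred P -> defPred Q -> defPred (fun e => P e -> Q e).
Proof.
apply: (@defPred_binary _ _ _ (@FImp L) (fun A B => A -> B)) => //.
by move=> A A' B B' -> ->.
Qed.

Lemma defPred_false (V : Type) : defPred (fun _ : V -> M => False).
Proof. by exists (@FFalse L), (fun _ => inr m0). Qed.

Lemma defPred_true (V : Type) : defPred (fun _ : V -> M => True).
Proof.
by exists (FImp (@FFalse L) (@FFalse L)), (fun _ => inr m0) => e /=.
Qed.

Lemma defPred_not (V : Type) (P : (V -> M) -> Prop) :
  defPred P -> defPred (fun e => ~ P e).
Proof. by move=> HP; apply: defPred_imp => //; exact: defPred_false. Qed.

Lemma defPred_equiv (V : Type) (P Q : (V -> M) -> Prop) :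
  defPred P -> defPred Q -> defPred (fun e => P e <-> Q e).
Proof. by move=> HP HQ; apply: defPred_and; apply: defPred_imp. Qed.

Lemma defPred_const (V : Type) (A : Prop) : defPred (fun _ : V -> M => A).
Proof.
have [a|na] := pselect A.
  by apply: (defPred_iff _ (defPred_true V)).
by apply: (defPred_iff _ (defPred_false V)).
Qed.

Lemma defPred_quantifier (V : Type) (Q : M -> (V -> M) -> Prop) :
  defPred (fun e : option V -> M => Q (e None) (fun i => e (Some i))) ->
  exists (p : formula L) (w : nat -> V + M),
    forall a e, Q a e <-> sat S (env_cons a (assign w e)) p.
Proof.
move=> [p [v Hp]].
pose w k := match v k with
  | inl (Some i) => inl i | inr c => inr c | inl None => inr m0 end : V + M.
(* Several variables of the formula may stand for [None]: all of them collapse to the bound index 0.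
   The value [m0] that [w] gives at these places is never read. *)
exists (rename (fun k => if v k is inl None then 0%N else k.+1) p), w => a e.
rewrite sat_rename; apply: iff_trans (Hp (opt_cons a e)) _.
rewrite (_ : assign v _ = env_cons a (assign w e)
  \o (fun k => if v k is inl None then 0%N else k.+1)) //.
apply: funext => k; rewrite /assign /=.
by case Ek: (v k) => [[i|]|c] //=; rewrite /assign /w Ek.
Qed.

Lemma defPred_ex (V : Type) (Q : M -> (V -> M) -> Prop) :
  defPred (fun e : option V -> M => Q (e None) (fun i => e (Some i))) ->
  defPred (fun e => exists a, Q a e).
Proof.
move=> /defPred_quantifier[p [w Hp]]; exists (FExists p), w => e /=.
by split=> -[a Ha]; exists a; apply/Hp.
Qed.

Lemma defPred_all (V : Type) (Q : M -> (V -> M) -> Prop) :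
  defPred (fun e : option V -> M => Q (e None) (fun i => e (Some i))) ->
  defPred (fun e => forall a, Q a e).
Proof.
move=> /defPred_quantifier[p [w Hp]]; exists (FForall p), w => e /=.
by split=> H a; apply/Hp.
Qed.

Lemma defPred_rename (V W : Type) (P : (V -> M) -> Prop) (g : V -> W + M) :
  defPred P ->
  defPred (fun e => P (fun i => match g i with inl j => e j | inr c => c end)).
Proof.
move=> [p [v Hp]].
exists p, (fun k => match v k with inl i => g i | inr c => inr c end) => e.
rewrite Hp (_ : assign v _ = assign (fun k =>
  match v k with inl i => g i | inr c => inr c end) e) //.
by apply: funext => k; rewrite /assign; case: (v k).
Qed.

Lemma defPred_vars (V W : Type) (P : (V -> M) -> Prop) (g : V -> W) :
  defPred P -> defPred (fun e => P (fun i => e (g i))).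
Proof. exact: (@defPred_rename V W P (fun i => inl (g i))). Qed.

Lemma defPred_eq_var (V : Type) (i j : V) : defPred (fun e => e i = e j).
Proof.
by exists (FEq (@Var L 0) (@Var L 1)), (fun k => if k is 0%N then inl i else inl j).
Qed.

Lemma defFun_var (V : Type) (i : V) : defFun (fun e => e i).
Proof. exact: defPred_eq_var. Qed.

Lemma defFun_cst (V : Type) (c : M) : defFun (fun _ : V -> M => c).
Proof.
by exists (FEq (@Var L 0) (@Var L 1)), (fun k => if k is 0%N then inl None else inr c).
Qed.

Lemma defPred_app1 (V : Type) (A : M -> Prop) (f : (V -> M) -> M) :
  defSet A -> defFun f -> defPred (fun e => A (f e)).
Proof.
(* A definable function is only known through its graph, so its value is introduced by an
   existential quantifier. *)
move=> HA Hf; apply: (@defPred_iff _ (fun e => exists a, a = f e /\ A a)).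
  by move=> e; split=> [[a [->]]|] //; exists (f e).
apply: defPred_ex; apply: defPred_and; first exact: Hf.
exact: (defPred_vars (fun _ => None) HA).
Qed.

Lemma defFun_vars (V W : Type) (f : (V -> M) -> M) (g : V -> W) :
  defFun f -> defFun (fun e => f (fun i => e (g i))).
Proof.
move=> Hf; rewrite /defFun.
exact: (defPred_vars (fun o : option V => if o is Some i then Some (g i) else None) Hf).
Qed.

Lemma defPred_app2 (V : Type) (T : M -> M -> Prop) (f g : (V -> M) -> M) :
  defRel T -> defFun f -> defFun g -> defPred (fun e => T (f e) (g e)).
Proof.
move=> HT Hf Hg.
apply: (@defPred_iff _ (fun e => exists a, a = f e /\ exists b, b = g e /\ T a b)).
  by move=> e; split=> [[a [-> [b [->]]]]|H] //; exists (f e); split=> //; exists (g e).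
apply: defPred_ex; apply: defPred_and; first exact: Hf.
apply: defPred_ex; apply: defPred_and; first exact: (defFun_vars Some Hg).
exact: (defPred_vars (fun b => if b then Some None else None) HT).
Qed.

Lemma defFun_app2 (V : Type) (op : M -> M -> M) (f g : (V -> M) -> M) :
  defPred (fun e : option bool -> M => e None = op (e (Some true)) (e (Some false))) ->
  defFun f -> defFun g -> defFun (fun e => op (f e) (g e)).
Proof.
move=> Hop Hf Hg; rewrite /defFun.
apply: (@defPred_iff _ (fun e : option V -> M =>
    exists a, a = f (fun i => e (Some i)) /\
    exists b, b = g (fun i => e (Some i)) /\ e None = op a b)).
  move=> e; split=> [[a [-> [b [->]]]]|H] //.
  by exists (f (fun i => e (Some i))); split=> //; exists (g (fun i => e (Some i))).
apply: defPred_ex; apply: defPred_and; first exact: (defFun_vars Some Hf).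
apply: defPred_ex; apply: defPred_and; first exact: (defFun_vars (Some \o Some) Hg).
exact: (defPred_vars (fun o => match o with None => Some (Some None)
  | Some true => Some None | Some false => None end) Hop).
Qed.

Lemma defFun_app1 (V : Type) (op : M -> M) (f : (V -> M) -> M) :
  defRel (fun y x => y = op x) ->
  defFun f -> defFun (fun e => op (f e)).
Proof.
move=> Hop Hf; rewrite /defFun.
apply: (@defPred_iff _ (fun e : option V -> M =>
    exists a, a = f (fun i => e (Some i)) /\ e None = op a)).
  move=> e; split=> [[a [->]]|H] //.
  by exists (f (fun i => e (Some i))).
apply: defPred_ex; apply: defPred_and; first exact: (defFun_vars Some Hf).
exact: (defPred_vars (fun b => if b then Some None else None) Hop).
Qed.

Lemma defPred_eq (V : Type) (f g : (V -> M) -> M) :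
  defFun f -> defFun g -> defPred (fun e => f e = g e).
Proof. by apply: defPred_app2; exact: defPred_eq_var. Qed.

Lemma defPred_finite_support (P : (nat -> M) -> Prop) : defPred P ->
  exists B : nat, forall e e', (forall k, (k < B)%N -> e k = e' k) -> P e <-> P e'.
Proof.
move=> [p [v Hp]]; have [B HB] := sat_finite_support S p.
exists (\max_(k < B) (if v k is inl i then i.+1 else 0%N)) => e e' H.
rewrite !Hp; apply: HB => k kB; rewrite /assign.
have := @leq_bigmax _ (fun k : 'I_B => if v k is inl i then i.+1 else 0%N) (Ordinal kB).
by rewrite /=; case: (v k) => // i iB; exact: H.
Qed.

(** Replaces an arbitrary type of variables by [nat], where parameters can be counted; index 0 is
    kept for the distinguished variable. *)
Lemma defPred_opt_nat (V : Type) (P : (option V -> M) -> Prop) : defPred P ->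
  exists (P' : (nat -> M) -> Prop) (h : (V -> M) -> nat -> M),
    defPred P' /\ forall a e, P (opt_cons a e) <-> P' (env_cons a (h e)).
Proof.
move=> [p [v Hp]].
pose w k := match v k with inl None => inl 0%N | inl (Some _) => inl k.+1
  | inr c => inr c end : nat + M.
exists (fun e => sat S (assign w e) p).
exists (fun e k => if v k is inl (Some i) then e i else m0).
split; first by exists p, w.
move=> a e; rewrite Hp.
rewrite (_ : assign w _ = assign v (opt_cons a e)) //.
by apply: funext => k; rewrite /assign /w; case Ek: (v k) => [[i|]|c] //=; rewrite Ek.
Qed.

End DefinablePredicates.

(** * Definability in a structure passes to its expansions *)

Section Inclusion.
Variables (L L' : language) (M : Type) (S : structure L M) (S' : structure L' M).

Fixpoint inl_term (t : term L) : term (language_sum L L') :=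
  match t with
  | Var n => @Var (language_sum L L') n
  | App f ts => @App (language_sum L L') (inl f) (fun i => inl_term (ts i))
  end.

Fixpoint inl_formula (p : formula L) : formula (language_sum L L') :=
  match p with
  | FFalse => @FFalse _
  | FEq t u => FEq (inl_term t) (inl_term u)
  | FRel r ts => @FRel (language_sum L L') (inl r) (fun i => inl_term (ts i))
  | FImp p q => FImp (inl_formula p) (inl_formula q)
  | FAnd p q => FAnd (inl_formula p) (inl_formula q)
  | FOr p q => FOr (inl_formula p) (inl_formula q)
  | FForall p => FForall (inl_formula p)
  | FExists p => FExists (inl_formula p)
  end.

Lemma eval_inl e t : Defs.eval (expansion S S') e (inl_term t) = Defs.eval S e t.
Proof. by elim: t => //= f ts IH; congr fun_interp; apply: funext. Qed.

Lemma sat_inl e p : sat (expansion S S') e (inl_formula p) <-> sat S e p.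
Proof.
elim: p e => //=.
- by move=> t u e; rewrite !eval_inl.
- move=> r ts e; rewrite (_ : (fun i => _) = (fun i => Defs.eval S e (ts i))) //.
  by apply: funext => i; rewrite eval_inl.
- by move=> p IHp q IHq e; rewrite IHp IHq.
- by move=> p IHp q IHq e; rewrite IHp IHq.
- by move=> p IHp q IHq e; rewrite IHp IHq.
- by move=> p IH e; split=> H a; move: (H a); rewrite IH.
- by move=> p IH e; split=> -[a H]; exists a; move: H; rewrite IH.
Qed.

Lemma defPred_inl (V : Type) (P : (V -> M) -> Prop) :
  defPred S P -> defPred (expansion S S') P.
Proof. by move=> [p [v Hp]]; exists (inl_formula p), v => e; rewrite sat_inl. Qed.

End Inclusion.

(** * Structures defining the ordered field operations, and automation of definability *)

Section DefinableField.
Variables (R : realType) (L : language) (S : structure L R).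

Definition defField : Prop :=
  [/\ defRel S (fun x y => x < y),
      defPred S (fun e : option bool -> R => e None = e (Some true) + e (Some false)) &
      defPred S (fun e : option bool -> R => e None = e (Some true) * e (Some false))].

Hypothesis Sfield : defField.

Lemma defPred_lt (V : Type) (f g : (V -> R) -> R) :
  defFun S f -> defFun S g -> defPred S (fun e => f e < g e).
Proof.
case: Sfield => Hlt _ _.
exact: (@defPred_app2 _ _ S 0 V (fun x y => x < y)).
Qed.

Lemma defPred_le (V : Type) (f g : (V -> R) -> R) :
  defFun S f -> defFun S g -> defPred S (fun e => f e <= g e).
Proof.
move=> Hf Hg; apply: (@defPred_iff _ _ _ _ (fun e => ~ (g e < f e))).
  by move=> e; split=> [/negP|H]; rewrite -?leNgt //; apply/negP; rewrite -leNgt.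
by apply: (defPred_not 0); exact: defPred_lt.
Qed.

Lemma defFun_add (V : Type) (f g : (V -> R) -> R) :
  defFun S f -> defFun S g -> defFun S (fun e => f e + g e).
Proof.
by case: Sfield => _ Hadd _; exact: (@defFun_app2 _ _ S 0 V (fun x y => x + y)).
Qed.

Lemma defFun_mul (V : Type) (f g : (V -> R) -> R) :
  defFun S f -> defFun S g -> defFun S (fun e => f e * g e).
Proof.
by case: Sfield => _ _ Hmul; exact: (@defFun_app2 _ _ S 0 V (fun x y => x * y)).
Qed.

Lemma defFun_opp (V : Type) (f : (V -> R) -> R) :
  defFun S f -> defFun S (fun e => - f e).
Proof.
apply: (@defFun_app1 _ _ S 0 V (fun x => - x)).
apply: (@defPred_iff _ _ _ _ (fun e : bool -> R => e true + e false = 0)).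
  by move=> e; split=> [/eqP|->]; rewrite ?addNr // addr_eq0 => /eqP.
apply: (defPred_eq 0); last exact: defFun_cst.
by apply: defFun_add; exact: defFun_var.
Qed.

Lemma defFun_norm (V : Type) (f : (V -> R) -> R) :
  defFun S f -> defFun S (fun e => `|f e|).
Proof.
apply: (@defFun_app1 _ _ S 0 V (fun x => `|x|)).
apply: (@defPred_iff _ _ _ _ (fun e : bool -> R =>
    (0 <= e false -> e true = e false) /\ (e false < 0 -> e true = - e false))).
  move=> e; split=> [[H1 H2]|->].
    have [h|h] := leP 0 (e false); first by rewrite ger0_norm // H1.
    by rewrite ltr0_norm // H2.
  by split=> h; [rewrite ger0_norm|rewrite ltr0_norm].
apply: defPred_and; apply: defPred_imp.
- by apply: defPred_le; [exact: defFun_cst|exact: defFun_var].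
- by apply: (defPred_eq 0); exact: defFun_var.
- by apply: defPred_lt; [exact: defFun_var|exact: defFun_cst].
- apply: (defPred_eq 0); first exact: defFun_var.
  by apply: defFun_opp; exact: defFun_var.
Qed.

End DefinableField.

Lemma defField_inl (R : realType) (L L' : language) (S : structure L R)
  (S' : structure L' R) : defField S -> defField (expansion S S').
Proof. by case=> *; split; apply: defPred_inl. Qed.

Lemma defField_expansion (R : realType) (L : language) (N : structure L R) :
  defField (expansion (ordered_field R) N).
Proof.
pose args (L0 : language) n : 'I_n -> term L0 := fun i => @Var L0 i.
split; apply: defPred_inl.
- exists (@FRel ordered_ring_language OLt (args _ 2%N)).
  by exists (fun k => if k is 0%N then inl true else inl false) => e.
- exists (FEq (@App ordered_ring_language OAdd (args _ 2%N)) (@Var _ 2)).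
  exists (fun k => match k with 0%N => inl (Some true) | 1%N => inl (Some false)
    | _ => inl None end) => e /=.
  by split=> H; exact: esym H.
- exists (FEq (@App ordered_ring_language OMul (args _ 2%N)) (@Var _ 2)).
  exists (fun k => match k with 0%N => inl (Some true) | 1%N => inl (Some false)
    | _ => inl None end) => e /=.
  by split=> H; exact: esym H.
Qed.

Ltac def_step :=
  cbv beta;
  first [ assumption | match goal with
  | |- defPred _ (fun e => @?P e /\ @?Q e) => apply: defPred_and
  | |- defPred _ (fun e => @?P e \/ @?Q e) => apply: defPred_or
  | |- defPred _ (fun e => @?P e <-> @?Q e) => apply: defPred_equiv
  | |- defPred _ (fun e => ~ @?P e) => apply: (defPred_not 0)
  | |- defPred _ (fun e => forall x : _, @?Q e x) => apply: (defPred_all 0)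
  | |- defPred _ (fun e => @?P e -> @?Q e) => apply: defPred_imp
  | |- defPred _ (fun e => exists x : _, @?Q e x) => apply: (defPred_ex 0)
  | |- defPred _ (fun e => is_true (@?f e < @?g e)) => apply: defPred_lt
  | |- defPred _ (fun e => is_true (@?f e <= @?g e)) => apply: defPred_le
  | |- defPred _ (fun e => @?f e = @?g e) => apply: (defPred_eq 0)
  | |- defFun _ (fun e => @?f e + @?g e) => apply: defFun_add
  | |- defFun _ (fun e => @?f e * @?g e) => apply: defFun_mul
  | |- defFun _ (fun e => - @?f e) => apply: defFun_opp
  | |- defFun _ (fun e => `|@?f e|) => apply: defFun_norm
  | |- defFun _ (fun e => ?c) => apply: defFun_cst
  | |- defFun _ (fun e => e ?i) => apply: defFun_var
  | H : defSet _ ?A |- defPred _ (fun e => ?A (@?f e)) =>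
      apply: (@defPred_app1 _ _ _ 0 _ A f H)
  | H : defRel _ ?T |- defPred _ (fun e => ?T (@?f e) (@?g e)) =>
      apply: (@defPred_app2 _ _ _ 0 _ T f g H)
  | H : defFun _ ?f |- defFun _ (fun e => ?f (@?h e)) => apply: (defFun_vars _ H)
  | H : defPred _ ?P |- defPred _ (fun e => ?P (@?h e)) => apply: (defPred_vars _ H)
  | |- defPred _ (fun e => ?c) => apply: (defPred_const 0)
  end ].
Ltac def_auto := repeat def_step.

(** * Auxiliary facts on finite and countable sets *)

(** Stated for preorders because it serves both for the order of the reals and for the order of
    enumeration, where ties occur. *)
Lemma finite_least (T : choiceType) (A : set T) (le : T -> T -> Prop) :
  finite_set A -> A !=set0 ->
  (forall x, A x -> le x x) ->
  (forall x y z, A x -> A y -> A z -> le x y -> le y z -> le x z) ->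
  (forall x y, A x -> A y -> le x y \/ le y x) ->
  exists2 x, A x & forall y, A y -> le x y.
Proof.
move=> /finite_seqP[s Hs] [x0 Ax0] lexx letr leto.
suff H : forall s' : seq T, (forall x, x \in s' -> A x) -> s' != [::] ->
    exists2 x, x \in s' & forall y, y \in s' -> le x y.
  have As x : x \in s <-> A x by rewrite Hs.
  have [||x xs xle] := H s; first by move=> x /As.
    by apply/eqP => s0; move: Ax0; rewrite Hs s0.
  by exists x; [apply/As|move=> y /As; exact: xle].
elim=> // a [|b s'] IH As' _.
  by exists a; [exact: mem_head|move=> y; rewrite inE => /eqP->; apply/lexx/As'/mem_head].
have [||x xs xle] := IH; [|by []|].
  by move=> x xs; apply: As'; rewrite inE xs orbT.
have Ax : A x by apply: As'; rewrite inE xs orbT.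
have Aa : A a by apply: As'; exact: mem_head.
case: (leto a x Aa Ax) => h.
  exists a; first exact: mem_head.
  move=> y; rewrite inE => /orP[/eqP->|ys]; first exact: lexx.
  by apply: (letr a x y) => //; [apply: As'; rewrite inE ys orbT|exact: xle].
exists x; first by rewrite inE xs orbT.
by move=> y; rewrite inE => /orP[/eqP->|ys] //; exact: xle.
Qed.

Lemma finite_subsingleton (T : choiceType) (A : set T) :
  (forall x y, A x -> A y -> x = y) -> finite_set A.
Proof.
move=> H; have [->|/set0P[x Ax]] := eqVneq A set0; first exact: finite_set0.
by apply: (@sub_finite_set _ _ [set x]); [move=> y Ay; exact: H|exact: finite_set1].
Qed.

(** A countable set is Lebesgue-null, whereas the interval has measure [v - u]. *)
Lemma interval_escapes_countable (R : realType) (A : set R) (u v : R) :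
  countable A -> u < v -> exists t, u < t /\ t < v /\ ~ A t.
Proof.
move=> Ac uv; apply: contrapT => H.
have sub : [set` `]u, v[%R] `<=` A.
  move=> x /=; rewrite in_itv /= => /andP[x1 x2]; apply: contrapT => nx.
  by apply: H; exists x.
have := countable_lebesgue_measure0 (sub_countable (subset_card_le sub) Ac).
rewrite lebesgue_measure_itv /= lte_fin uv.
by rewrite -EFinB => /eqP; rewrite eqe => /eqP; lra.
Qed.

(** * Coding finite sets by a dense set enumerated in finite stages, and defining the integers *)

Section DenseStratified.
Variables (R : realType) (F : R -> Prop) (B : R -> R -> Prop).
Hypotheses (Brefl : forall v, F v -> B v v)
  (Btrans : forall u v w, B u v -> B v w -> B u w)
  (Btotal : forall u v, F u -> F v -> B u v \/ B v u)
  (Bfinite : forall v, F v -> finite_set [set w | F w /\ B w v]).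

(* B w v means that w is enumerated no later than v. *)
Definition is_gap (v rho : R) : Prop :=
  (exists w, F w /\ (B w v /\ (w <> v /\ rho = `|w - v|))) /\
  forall w, F w -> B w v -> w <> v -> rho <= `|w - v|.

Lemma is_gap_exists (v : R) : F v -> (exists2 w, F w & B w v /\ w <> v) ->
  exists rho, is_gap v rho.
Proof.
move=> Fv [w0 Fw0 [Bw0 nw0]].
have [|||||m [w [Fw [Bw nw]] <-] mle] := @finite_least R
    ((fun w => `|w - v|) @` [set w | F w /\ (B w v /\ w <> v)]) (fun x y => x <= y).
- apply: finite_image; apply: sub_finite_set (Bfinite Fv).
  by move=> w [Fw [Bw _]].
- by exists `|w0 - v|; exists w0.
- by [].
- by move=> x y z _ _ _; exact: le_trans.
- by move=> x y _ _; have [|/ltW] := leP x y; [left|right].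
exists `|w - v|; split; first by exists w.
by move=> w' Fw' Bw' nw'; apply: mle; exists w'.
Qed.

Lemma is_gap_gt0 v rho : is_gap v rho -> 0 < rho.
Proof. by case=> -[w [_ [_ [nw ->]]]] _; rewrite normr_gt0 subr_eq0; apply/eqP. Qed.

Lemma is_gap_inj v rho rho' : is_gap v rho -> is_gap v rho' -> rho = rho'.
Proof.
move=> [[w [Fw [Bw [nw ->]]]] h] [[w' [Fw' [Bw' [nw' ->]]]] h'].
by apply/eqP; rewrite eq_le h' ?h.
Qed.

Variables (alpha beta : R).
Hypothesis (Fdense : forall x eta : R, alpha < x -> x < beta -> 0 < eta ->
  exists2 v, F v & `|v - x| < eta).

(** Only finitely many points come no later than [e]. Some [a] near [m] avoids them with a margin
    [eta], and a point of [F] within [eta] of [a] must be later. *)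
Lemma later_point (e m w : R) : F e -> 0 < w ->
  (forall x : R, `|x - m| < w -> alpha < x /\ x < beta) ->
  exists2 q, F q & ~ B q e /\ `|q - m| < w.
Proof.
move=> Fe w0 mw; have Hfin := Bfinite Fe.
have [|a [a1 [a2 na]]] := @interval_escapes_countable _
  [set u | F u /\ B u e] (m - w) (m + w) (finite_set_countable Hfin); first lra.
have am : `|a - m| < w by rewrite ltr_distl a1 a2.
pose d := w - `|a - m|.
have d0 : 0 < d by rewrite /d subr_gt0.
have [eta [eta0 etad Heta]] : exists eta, [/\ 0 < eta, eta <= d &
    forall u, F u -> B u e -> eta <= `|u - a|].
  have [E|/set0P[u0 Eu0]] := eqVneq [set u | F u /\ B u e] set0.
    exists d; split=> // u Fu Bu.
    by have : [set u | F u /\ B u e] u by []; rewrite E.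
  have [|||||r [u [Fu Bu] <-] rle] := @finite_least R
      ((fun u => `|u - a|) @` [set u | F u /\ B u e]) (fun x y => x <= y).
  - exact: finite_image.
  - by exists `|u0 - a|; exists u0.
  - by [].
  - by move=> x y z _ _ _; exact: le_trans.
  - by move=> x y _ _; have [|/ltW] := leP x y; [left|right].
  exists (Num.min d `|u - a|); split.
  - rewrite lt_min d0 normr_gt0 subr_eq0 /=; apply/eqP => ua.
    by apply: na; rewrite -ua.
  - by rewrite ge_min lexx.
  - by move=> u' Fu' Bu'; rewrite ge_min; apply/orP; right; apply: rle; exists u'.
have [ax xb] := mw a am.
have [q Fq qa] := Fdense ax xb eta0.
exists q => //; split; first by move=> /(Heta q Fq); rewrite leNgt qa.
have := ler_distD a q m; rewrite /d in etad; lra.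
Qed.

Section Coding.
Variable eps : R.
Hypotheses (eps0 : 0 < eps) (eps10 : 10 * eps <= 1).

Definition selected (c v rho : R) : Prop :=
  is_gap v rho /\ (0 < v - c /\ v - c < eps * rho).

(** One step of the coding: just left of [q] there is a whole interval of values of [c] that select
    [q] and no other point enumerated after [e] and up to [q]. The later steps choose [c] inside
    this interval. *)
Lemma next_selected (e m w : R) : F e -> 0 < w ->
  (forall x : R, `|x - m| < w -> alpha < x /\ x < beta) ->
  32 * (eps * (`|m - e| + w)) <= w ->
  exists q rho, [/\ F q, ~ B q e, is_gap q rho &
    forall c : R, 0 < q - c -> q - c < eps * rho -> `|c - m| < w /\
      forall v r, F v -> B v q -> ~ B v e -> v <> q -> ~ selected c v r].
Proof.
move=> Fe w0 mw ew; have e10 := eps10.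
have [||p Fp [npe pm]] := @later_point e m (w / 2) Fe.
- lra.
- by move=> x xm; apply: mw; lra.
have gapE v : F v -> ~ B v e -> exists r, is_gap v r.
  move=> Fv nve; apply: is_gap_exists => //; exists e => //.
  by case: (Btotal Fv Fe) => // Bev; split=> // ev; apply: nve; rewrite -ev; exact: Brefl.
(* The earliest point q of X is the next selected one: had an earlier v
   selected some c close to q, then v would belong to X as well. *)
pose X := [set v | F v /\ B v p /\ ~ B v e /\
  forall r, is_gap v r -> `|p - v| <= 4 * (eps * r)].
have Xp : X p.
  split=> //; split; first exact: Brefl.
  split=> // r /is_gap_gt0 r0; rewrite subrr normr0.
  have : 0 < eps * r by apply: mulr_gt0.
  lra.
have [|||||q [Fq [Bqp [nqe Hq]]] qle] := @finite_least R X B.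
- by apply: sub_finite_set (Bfinite Fp) => v [Fv [Bv _]].
- by exists p.
- by move=> v [Fv _]; exact: Brefl.
- by move=> x y z _ _ _; exact: Btrans.
- by move=> x y [Fx _] [Fy _]; exact: Btotal.
have [rho gq] := gapE q Fq nqe.
exists q, rho; split=> // c c0 crho.
have rho0 := is_gap_gt0 gq.
have Beq : B e q by case: (Btotal Fq Fe).
have neq : e <> q by move=> E; apply: nqe; rewrite -E; exact: Brefl.
have rhoe : rho <= `|e - q| by case: gq => _; apply.
have pq := Hq _ gq.
pose t := eps * rho; rewrite -/t in crho pq.
have t0 : 0 < t by apply: mulr_gt0.
(* As [e] precedes [q], the gap of [q] is at most [|e - q|]. This makes [t] small against [w],
   namely [5 * t + w / 2 < w]. *)
have rhole : rho <= 4 * t + (w / 2) + `|m - e|.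
  have := ler_distD p e q; have := ler_distD m e p.
  by rewrite (distrC e m) (distrC m p) in rhoe * ; lra.
have tle : t <= 4 * (eps * t) + eps * (`|m - e| + w).
  have : t <= eps * (4 * t + (w / 2) + `|m - e|) by rewrite ler_pM2l.
  have : 0 <= eps * w by apply: mulr_ge0; exact: ltW.
  lra.
have et : eps * t <= t / 10. by rewrite mulrC ler_pM2l //; lra.
split.
  have h1 := ler_distD q c m; have h2 := ler_distD p q m.
  have h3 : `|c - q| = q - c by rewrite distrC gtr0_norm.
  by rewrite (distrC q p) in h2; lra.
move=> v r Fv Bvq nve nvq [gv [vc1 vc2]].
have r0 := is_gap_gt0 gv.
have rhov : rho <= `|v - q| by case: gq => _; apply.
pose s := eps * r; rewrite -/s in vc2.
have s0 : 0 < s by apply: mulr_gt0.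
have vq : `|v - q| < t + s.
  have := ler_distD c v q; rewrite (distrC c q) (gtr0_norm vc1) (gtr0_norm c0); lra.
have ts : t <= (t + s) / 10.
  have : t <= eps * (t + s) by rewrite ler_pM2l //; lra.
  have : (t + s) * eps <= (t + s) * (1 / 10) by rewrite ler_pM2l; lra.
  lra.
(* If [q] and [v] are enumerated together, each bounds the gap of the other, and
   [r <= |v - q| < t + s] contradicts the smallness of [s] against [r]. Otherwise [9 * t <= s] puts
   [v] in [X], against the choice of [q]. *)
have [Bqv|nBqv] := pselect (B q v).
  have rv : r <= `|v - q|.
    by rewrite distrC; case: gv => _; apply=> // E; apply: nvq.
  have : s <= r / 10 by rewrite /s mulrC ler_pM2l //; lra.
  lra.
apply: nBqv; apply: qle; split=> //; split; first exact: Btrans Bqp.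
split=> // r' gv'; rewrite (is_gap_inj gv' gv) -/s.
have h1 := ler_distD q p v; rewrite (distrC q v) in h1.
lra.
Qed.

Variable delta : R.
Hypotheses (delta0 : 0 < delta) (eps64 : 64 * eps <= delta).

(** Induction on the targets: take the next selected point [q], then confine [c] to the window of
    radius [delta * eps * rho] around [q - y * eps * rho], where the label of [q] is [y] up to
    [delta]. As [64 * eps <= delta], this window is wide enough for the smallness condition to hold
    again, now starting from [q]. *)
Lemma code_targets (ys : seq R) : (forall y, y \in ys -> delta < y /\ y + delta < 1) ->
  forall e m w : R, F e -> 0 < w ->
  (forall x : R, `|x - m| < w -> alpha < x /\ x < beta) ->
  32 * (eps * (`|m - e| + w)) <= w ->
  exists e' c, [/\ F e', B e e', `|c - m| < w,
    (forall v rho, F v -> ~ B v e -> B v e' -> selected c v rho ->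
      exists2 y, y \in ys & `|v - c - y * (eps * rho)| < delta * (eps * rho)) &
    (forall y, y \in ys -> exists v rho, [/\ F v, ~ B v e, B v e', selected c v rho &
      `|v - c - y * (eps * rho)| < delta * (eps * rho)])].
Proof.
elim: ys => [_|y ys IH Hys] e m w Fe w0 mw ew.
  exists e, m; split=> //; first exact: Brefl.
  by rewrite subrr normr0.
have e64 := eps64; have d0 := delta0.
have [q [rho [Fq nqe gq Hq]]] := next_selected Fe w0 mw ew.
have rho0 := is_gap_gt0 gq.
have Beq : B e q by case: (Btotal Fq Fe).
pose t := eps * rho; have t0 : 0 < t by apply: mulr_gt0.
have dt0 : 0 < delta * t by apply: mulr_gt0.
have [y1 y2] := Hys y (mem_head _ _).
have yt0 : delta * t < y * t by rewrite ltr_pM2r.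
have yt1 : (y + delta) * t < t by rewrite gtr_pMl.
have near c : `|c - (q - y * t)| < delta * t -> 0 < q - c /\ q - c < t.
  by rewrite ltr_distl => /andP[]; lra.
have [|||e' [c [Fe' Bqe' cm H1 H2]]] := IH _ q (q - y * t) (delta * t) Fq dt0.
- by move=> z zs; apply: Hys; rewrite inE zs orbT.
- move=> x /near[x1 x2]; apply: mw.
  by have [] := Hq x x1 x2.
- rewrite (_ : q - y * t - q = - (y * t)); last lra.
  rewrite normrN gtr0_norm; last lra.
  have : eps * (y * t + delta * t) <= eps * (2 * t) by rewrite ler_pM2l //; lra.
  have : 64 * eps * t <= delta * t by rewrite ler_pM2r.
  lra.
have [c0 ct] := near c cm.
have [cmw Hc] := Hq c c0 ct.
have qc : `|q - c - y * t| < delta * t.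
  by rewrite distrC (_ : y * t - (q - c) = c - (q - y * t)) //; lra.
exists e', c; split=> //.
- exact: Btrans Bqe'.
- move=> v r Fv nve Bve' sv.
  have [Bvq|nBvq] := pselect (B v q).
    have [vq|nvq] := pselect (v = q).
      exists y; first exact: mem_head.
      rewrite vq in sv *; case: sv => gq' _.
      by rewrite (is_gap_inj gq' gq).
    by case: (Hc v r Fv Bvq nve nvq sv).
  have [z zs Hz] := H1 v r Fv nBvq Bve' sv.
  by exists z => //; rewrite inE zs orbT.
- move=> z; rewrite inE => /orP[/eqP->|/H2].
    by exists q, rho; split.
  move=> [v [r [Fv nvq Bve' sv Hv]]]; exists v, r; split=> // Bve.
  by apply: nvq; exact: Btrans Beq.
Qed.

End Coding.

(** Labels lie in ]0, 1[; the factor [s] rescales them, so that the coded finite sets may spread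
    over any length. *)
Definition coded (eps c e e' s z : R) : Prop :=
  exists v rho, F v /\ (~ B v e /\ (B v e' /\ (selected eps c v rho /\
    (v - c) * s = z * (eps * rho)))).

(* The coded finite set descends from x + 1 to 1 in steps of length close to 1. *)
Definition approx_nat (x : R) : Prop :=
  forall delta : R, 0 < delta -> 4 * delta < 1 ->
  exists eps c e e' s, F e' /\
    ((exists z, coded eps c e e' s z /\ `|z - (x + 1)| < delta) /\
    (forall z, coded eps c e e' s z -> `|z - 1| < delta \/
      exists z', coded eps c e e' s z' /\ `|z' - (z - 1)| < delta)).

Lemma coded_finite eps c e e' s : F e' -> finite_set [set z | coded eps c e e' s z].
Proof.
move=> Fe'; pose G v := [set z | exists rho, selected eps c v rho /\
  (v - c) * s = z * (eps * rho)].
apply: (@sub_finite_set _ _ (\bigcup_(v in [set v | F v /\ B v e']) G v)).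
  by move=> z [v [rho [Fv [_ [Bv Hv]]]]]; exists v => //; exists rho.
apply: bigcup_finite; first exact: Bfinite.
move=> v _; apply: finite_subsingleton => z z' [r [[gr [h1 h2]] E]] [r' [[gr' _] E']].
rewrite -(is_gap_inj gr gr') E in E'.
by apply: (mulIf _ E'); apply: lt0r_neq0; exact: lt_trans h2.
Qed.

(** In a finite coded set the descent from a point near [x + 1] must stop near 1, and its error
    grows by [delta] at each step. So [x] is within [(k + 2) * delta] of some natural number [k];
    for small [delta] this [k] is always the same, and letting [delta] shrink gives [x = k]. *)
Lemma approx_natP (x : R) : approx_nat x -> exists n : nat, x = n%:R.
Proof.
move=> H.
have near (delta : R) : 0 < delta -> 4 * delta < 1 ->
    exists k : nat, `|x - k%:R| < (k%:R + 2) * delta.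
  move=> d0 d4; have [eps [c [e [e' [s [Fe' [[z [Cz zx]] Hz]]]]]]] := H _ d0 d4.
  suff [k Hk] : exists k : nat, `|z - 1 - k%:R| < (k%:R + 1) * delta.
    exists k; have := ler_distD (z - 1) x k%:R.
    by rewrite (_ : x - (z - 1) = - (z - (x + 1))) ?normrN; lra.
  apply: contrapT => nz.
  (* A least bad point is impossible: its successor in the descent is smaller, hence good, and one
     more step makes the point itself good. *)
  pose bad := [set z | coded eps c e e' s z /\
    ~ exists k : nat, `|z - 1 - k%:R| < (k%:R + 1) * delta].
  have [|||||y [Cy ny] yle] := @finite_least R bad (fun x y => x <= y).
  - by apply: sub_finite_set (@coded_finite eps c e e' s Fe') => y [].
  - by exists z.
  - by [].
  - by move=> *; apply: le_trans; eassumption.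
  - by move=> a b _ _; have [|/ltW] := leP a b; [left|right].
  case: (Hz y Cy) => [y1|[y' [Cy' Hy']]].
    by apply: ny; exists 0%N; rewrite subr0 add0r mul1r.
  apply: ny; have : ~ bad y'.
    by move=> /yle; move: Hy'; rewrite ltr_distl => /andP[]; lra.
  move=> /not_andP[//|/contrapT[k Hk]]; exists k.+1.
  rewrite -natr1; have := ler_distD (y' - 1 + 1) (y - 1) (k%:R + 1).
  rewrite (_ : y - 1 - (y' - 1 + 1) = - (y' - (y - 1))) ?normrN; last lra.
  rewrite (_ : y' - 1 + 1 - (k%:R + 1) = y' - 1 - k%:R); last lra.
  lra.
(* Below [D0] the error [(k + 2) * delta] stays under 1/4 for every admissible [k], as
   [k <= 2 * |x| + 2]. Two values of [delta] then give the same [k]. *)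
pose D0 : R := (16 * (`|x| + 4))^-1.
have X0 : 0 < 16 * (`|x| + 4) by have := normr_ge0 x; lra.
have D00 : 0 < D0 by rewrite invr_gt0.
have D0x : D0 * (16 * (`|x| + 4)) = 1 by rewrite mulVf // gt_eqF.
have Dx : 0 <= D0 * `|x| by apply: mulr_ge0 => //; exact: ltW.
have xle : x <= `|x| by exact: ler_norm.
have kle (delta : R) (k : nat) : 0 < delta -> delta <= D0 ->
    `|x - k%:R| < (k%:R + 2) * delta -> (k%:R + 2) * delta < 1 / 4.
  move=> d0 dD; rewrite ltr_distl => /andP[h1 h2].
  have k0 : 0 <= k%:R :> R by [].
  have h3 : (k%:R + 2) * delta <= (k%:R + 2) * D0 by rewrite ler_pM2l //; lra.
  have D64 : D0 <= 1 / 64 by lra.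
  have h4 : (k%:R + 2) * D0 <= (k%:R + 2) * (1 / 64) by rewrite ler_pM2l //; lra.
  have h5 : k%:R <= 2 * `|x| + 2 by lra.
  have h6 : (k%:R + 2) * D0 <= (2 * `|x| + 4) * D0 by rewrite ler_pM2r //; lra.
  lra.
have [|k0 Hk0] := near D0 D00; first lra.
exists k0; apply/eqP; rewrite -subr_eq0 -normr_eq0; apply/eqP.
apply: contrapT => /eqP nx; have N0 : 0 < `|x - k0%:R|.
  by rewrite lt_neqAle eq_sym nx normr_ge0.
have b0 := kle D0 k0 D00 (lexx _) Hk0.
have K0 : 0 < k0%:R + 2 :> R by have : 0 <= k0%:R :> R by []; lra.
(* If [x] differed from [k0], this precision would separate them. *)
pose d := Num.min D0 (`|x - k0%:R| / (k0%:R + 2)).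
have d0 : 0 < d by rewrite lt_min D00 divr_gt0.
have dD : d <= D0 by rewrite ge_min lexx.
have [|k Hk] := near d d0; first lra.
have b := kle d k d0 dD Hk.
have kk : k = k0.
  move: Hk Hk0; rewrite !ltr_distl => /andP[h1 h2] /andP[h3 h4].
  case: (ltngtP k k0) => // h.
    by exfalso; move: h; rewrite -(ler_nat R) -natr1; lra.
  by exfalso; move: h; rewrite -(ler_nat R) -natr1; lra.
move: Hk; rewrite kk => Hk.
have : d * (k0%:R + 2) <= `|x - k0%:R|.
  by rewrite -ler_pdivlMr // ge_min lexx orbT.
lra.
Qed.

Hypothesis (alpha_beta : alpha < beta).

Lemma nat_approx (n : nat) : approx_nat n%:R.
Proof.
(* The labels will be [j / s] for [1 <= j <= n + 1]; this [s] keeps them at a distance more than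
   [dl] from both 0 and 1. *)
move=> delta d0 d4; pose s : R := n%:R + 3.
have n0 : 0 <= n%:R :> R by [].
have s0 : 0 < s by rewrite /s; lra.
(* Rescaling turns an error [dl] on labels into [delta / 4]; a step of the descent compares two
   coded points, each known up to [delta / 2]. *)
pose dl := delta / (4 * s); pose eps := Num.min (1 / 10) (dl / 64).
have dl0 : 0 < dl by apply: divr_gt0; lra.
have dls : dl * s = delta / 4 by rewrite /dl; field; rewrite gt_eqF.
have eps0 : 0 < eps by rewrite lt_min; apply/andP; split; lra.
have eps10 : 10 * eps <= 1.
  have : eps <= 1 / 10 by rewrite ge_min lexx.
  lra.
have eps64 : 64 * eps <= dl.
  have : eps <= dl / 64 by rewrite ge_min lexx orbT.
  lra.
have eps32 : 32 * eps <= 1.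
  have : dl * 3 <= dl * s by rewrite ler_pM2l // /s; lra.
  lra.
have ab := alpha_beta.
have [|||e Fe em] := @Fdense ((alpha + beta) / 2) ((beta - alpha) / 2); try lra.
have [ea eb] : alpha < e /\ e < beta by move: em; rewrite ltr_distl => /andP[]; lra.
pose w := Num.min (e - alpha) (beta - e).
have w0 : 0 < w by rewrite lt_min; apply/andP; split; lra.
have wa : w <= e - alpha by rewrite ge_min lexx.
have wb : w <= beta - e by rewrite ge_min lexx orbT.
pose ys := [seq j.+1%:R / s | j <- iota 0 n.+1].
have ysP y : y \in ys -> exists2 j, (j < n.+1)%N & y = j.+1%:R / s.
  by move=> /mapP[j]; rewrite mem_iota /= => jn ->; exists j.
have Hys y : y \in ys -> dl < y /\ y + dl < 1.
  move=> /ysP[j jn ->]; have jn' : j%:R <= n%:R :> R by rewrite ler_nat -ltnS.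
  have j0 : 0 <= j%:R :> R by [].
  have j1 : j.+1%:R = j%:R + 1 :> R by rewrite natr1.
  split; first by rewrite ltr_pdivlMr // dls j1; lra.
  rewrite -(ltr_pM2r s0) mulrDl dls divfK ?gt_eqF // mul1r j1 /s; lra.
have mw x : `|x - e| < w -> alpha < x /\ x < beta.
  by rewrite ltr_distl => /andP[]; lra.
have [|e' [c [Fe' Bee' _ H1 H2]]] := code_targets eps0 eps10 dl0 eps64 Hys Fe w0 mw.
  rewrite subrr normr0 add0r mulrA; have : 32 * eps * w <= 1 * w by rewrite ler_pM2r.
  lra.
have near z y a v rho : selected eps c v rho -> (v - c) * s = z * (eps * rho) ->
    `|v - c - y * (eps * rho)| < dl * (eps * rho) -> y * s = a -> `|z - a| < delta / 2.
  move=> [gv _] E Hv <-; have rho0 := is_gap_gt0 gv.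
  have t0 : 0 < eps * rho by apply: mulr_gt0.
  rewrite -(ltr_pM2r t0) -(gtr0_norm t0) -normrM mulrBl -E (gtr0_norm t0).
  rewrite (_ : _ - _ = (v - c - y * (eps * rho)) * s); last by ring.
  rewrite normrM (gtr0_norm s0).
  have : `|v - c - y * (eps * rho)| * s < dl * (eps * rho) * s by rewrite ltr_pM2r.
  have : dl * (eps * rho) * s = (dl * s) * (eps * rho) by ring.
  rewrite dls => ->; have : 0 < delta * (eps * rho) by apply: mulr_gt0.
  lra.
have reach j : (j < n.+1)%N ->
    exists2 z, coded eps c e e' s z & `|z - (j%:R + 1)| < delta / 2.
  move=> jn; have [|v [rho [Fv nve Bve' sv Hv]]] := H2 (j.+1%:R / s).
    by apply/mapP; exists j => //; rewrite mem_iota.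
  have t0 : eps * rho != 0.
    by case: sv => /is_gap_gt0 rho0 _; rewrite mulf_neq0 // gt_eqF.
  have E : (v - c) * s = (v - c) * s / (eps * rho) * (eps * rho) by rewrite divfK.
  exists ((v - c) * s / (eps * rho)); first by exists v, rho.
  by apply: near sv E Hv _; rewrite divfK ?gt_eqF // natr1.
exists eps, c, e, e', s; split=> //; split.
  by have [z Cz Hz] := reach n (ltnSn n); exists z; split=> //; lra.
move=> z [v [rho [Fv [nve [Bve' [sv E]]]]]].
have [y /ysP[j jn ->] Hy] := H1 v rho Fv nve Bve' sv.
have := near _ _ (j%:R + 1) _ _ sv E Hy.
rewrite divfK ?gt_eqF // natr1 => /(_ erefl).
case: j jn {Hy} => [_ Hz|j jn Hz]; first by left; lra.
right; have [z' Cz' Hz'] := reach j (ltnW jn); exists z'; split=> //.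
have j2 : j.+2%:R = j%:R + 1 + 1 :> R by rewrite !natr1.
rewrite j2 in Hz.
have := ler_distD (j%:R + 1) z' (z - 1).
rewrite (_ : j%:R + 1 - (z - 1) = - (z - (j%:R + 1 + 1))); last lra.
rewrite normrN; lra.
Qed.

Lemma approx_nat_int : range (fun z : int => z%:~R) =
  [set x : R | approx_nat x \/ approx_nat (- x)].
Proof.
apply/seteqP; split=> x /=.
  move=> [[n|n] _ <-]; first by left; exact: nat_approx.
  by right; rewrite NegzE mulrNz opprK; exact: nat_approx.
case=> /approx_natP[n xn]; first by exists n%:Z.
by exists (- n%:Z) => //; rewrite mulrNz -[LHS]/(- n%:R) -xn opprK.
Qed.

End DenseStratified.

(** The defining formula quantifies over real numbers only: finite sets enter through their codes
    [eps], [c], [e], [e'], [s], and their finiteness comes from the enumeration. *)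
Lemma dense_stratified_defines_int (R : realType) (L : language)
    (S : structure L R) (F : R -> Prop) (B : R -> R -> Prop) (alpha beta : R) :
  defField S -> defSet S F -> defRel S B ->
  (forall v, F v -> B v v) -> (forall u v w, B u v -> B v w -> B u w) ->
  (forall u v, F u -> F v -> B u v \/ B v u) ->
  (forall v, F v -> finite_set [set w | F w /\ B w v]) ->
  alpha < beta ->
  (forall x eta : R, alpha < x -> x < beta -> 0 < eta ->
    exists2 v, F v & `|v - x| < eta) ->
  definable S (range (fun z : int => z%:~R)).
Proof.
move=> Sf DF DB h1 h2 h3 h4 h5 h6.
apply/(definableP S 0); rewrite (approx_nat_int h1 h2 h3 h4 h6 h5).
have Hgap : defRel S (is_gap F B) by rewrite /defRel /is_gap; def_auto.
rewrite /defSet /approx_nat /coded /selected /=; def_auto.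
Qed.

(** * Jumps of a set of reals, and constancy between jumps *)

Lemma seq_gap (R : realType) (s : seq R) (u : R) :
  exists2 eta : R, 0 < eta & forall x, x \in s -> x != u -> eta <= `|x - u|.
Proof.
elim: s => [|x s [eta eta0 H]]; first by exists 1.
have [->|xu] := eqVneq x u.
  by exists eta => // y; rewrite inE => /orP[/eqP->|/H//]; rewrite eqxx.
exists (Num.min eta `|x - u|); first by rewrite lt_min eta0 normr_gt0 subr_eq0.
move=> y; rewrite inE ge_min => /orP[/eqP-> _|/H h /h ->] //.
by rewrite lexx orbT.
Qed.

Lemma finite_separated (R : realType) (A : set R) : finite_set A ->
  exists2 d : R, 0 < d & forall y z, A y -> A z -> y <> z -> d <= `|y - z|.
Proof.
move=> /finite_seqP[s ->] {A}.
elim: s => [|x s [d d0 H]]; first by exists 1.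
have [eta eta0 Heta] := seq_gap s x.
exists (Num.min eta d); first by rewrite lt_min eta0.
move=> y z /=; rewrite !inE => /orP[/eqP->|ys] /orP[/eqP->|zs] yz //.
- rewrite ge_min distrC Heta //; apply/eqP => zx; exact: yz.
- by rewrite ge_min Heta //; apply/eqP.
- by rewrite ge_min H ?orbT.
Qed.

(** These are the boundary points of [A], in a first-order form. *)
Definition jump (R : realType) (A : R -> Prop) (u : R) : Prop :=
  forall eta : R, 0 < eta -> exists v, `|v - u| < eta /\ ~ (A v <-> A u).

Lemma not_jump (R : realType) (A : R -> Prop) u : ~ jump A u ->
  exists2 eta : R, 0 < eta & forall v, `|v - u| < eta -> (A v <-> A u).
Proof.
move=> nj; apply: contrapT => H; apply: nj => eta eta0.
apply: contrapT => H'; apply: H; exists eta => // v vu.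
by apply: contrapT => nv; apply: H'; exists v.
Qed.

(** Connectedness of the segment: the supremum of the points related to [a] is itself related to
    [a], and its neighbours would be too if it were less than [b]. *)
Lemma locally_constant_const (R : realType) (P : R -> R -> Prop) (a b : R) :
  (forall x y z, P x y -> P y z -> P x z) -> (forall x y, P x y -> P y x) ->
  (forall t, a <= t -> t <= b -> exists2 eta : R, 0 < eta &
    forall t', `|t' - t| < eta -> P t t') ->
  a <= b -> P a b.
Proof.
move=> Ptr Psym Hloc ab.
pose A := [set t | a <= t /\ t <= b /\ P a t].
have Paa : P a a.
  by have [eta eta0] := Hloc a (lexx a) ab; apply; rewrite subrr normr0.
have Aa : A a by [].
have Asup : has_sup A by split; [exists a|exists b => t [_ []]].
have at0 : a <= sup A by apply: ub_le_sup => //; case: Asup.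
have t0b : sup A <= b by apply: ge_sup; [exists a|move=> t [_ []]].
have [eta eta0 Heta] := Hloc _ at0 t0b.
have [t At tsup] := @sup_adherent _ _ _ eta0 Asup.
have Pat : P a t by case: At => _ [].
have Past : P a (sup A).
  have [tle|tgt] := leP t (sup A).
    apply: Ptr Pat _; apply: Psym; apply: Heta.
    by rewrite ltr_distl; apply/andP; split; lra.
  apply: Ptr Pat _; apply: Psym; apply: Heta.
  have : t <= sup A by apply: ub_le_sup => //; case: Asup.
  lra.
have [->//|nb] := eqVneq b (sup A).
have ltb : sup A < b by rewrite lt_neqAle eq_sym nb.
pose t' := Num.min b (sup A + eta / 2).
have t'b : t' <= b by rewrite ge_min lexx.
have t'e : t' <= sup A + eta / 2 by rewrite ge_min lexx orbT.
have t's : sup A < t' by rewrite lt_min ltb /=; lra.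
have : A t'.
  split; first lra.
  split=> //; apply: Ptr Past _; apply: Heta.
  by rewrite ltr_distl; apply/andP; split; lra.
move=> At'; have : t' <= sup A by apply: ub_le_sup => //; case: Asup.
lra.
Qed.

Lemma no_jump_const (R : realType) (A : R -> Prop) (a b : R) : a <= b ->
  (forall u, a <= u -> u <= b -> ~ jump A u) -> (A a <-> A b).
Proof.
move=> ab H; apply: (@locally_constant_const R (fun x y => A x <-> A y)) => //.
- by move=> x y z -> ->.
- by move=> x y ->.
- by move=> t at_ tb; have [eta eta0 h] := not_jump (H t at_ tb); exists eta => // t' /h ->.
Qed.

(** * Finiteness of jumps, and stability of families with finite fibres *)

Section OMinimal.
Variables (R : realType) (L : language) (S : structure L R).
Hypotheses (Sf : defField S) (Somin : o_minimal S).

Lemma finite_jumps (A : R -> Prop) : defSet S A -> finite_set [set u | jump A u].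
Proof.
move=> /(definableP S 0) /Somin[pts [itvs HA]].
(* [fine] sends infinite endpoints to 0, which merely adds a point to [s]. Near any [u] outside [s],
   no comparison with an endpoint changes. *)
pose s := pts ++ [seq fine ab.1 | ab <- itvs] ++ [seq fine ab.2 | ab <- itvs].
apply: (@sub_finite_set _ _ [set` s]); last by apply/finite_seqP; exists s.
move=> u ju /=; apply: contrapT => us.
have [eta eta0 Heta] := seq_gap s u.
have [v [vu]] := ju eta eta0; apply.
have side r : r \in s -> ((r < v) = (r < u)) * ((v < r) = (u < r)) * (v != r).
  move=> rs; have ru : r != u by apply/eqP => E; apply: us; rewrite -E.
  move: (Heta r rs ru) vu; rewrite ltr_distl => h /andP[h1 h2].
  have [h3|h3] := ltP u r.
    have ru' : `|r - u| = r - u by rewrite gtr0_norm // subr_gt0.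
    have vr : v < r by lra.
    by rewrite vr (lt_eqF vr) (lt_gtF vr) (lt_gtF h3).
  have {}h3 : r < u by rewrite lt_neqAle ru.
  have ru' : `|r - u| = u - r by rewrite distrC gtr0_norm // subr_gt0.
  have rv : r < v by lra.
  by rewrite rv h3 (gt_eqF rv) (lt_gtF rv).
have sidel (a : \bar R) : fine a \in s -> (a < v%:E)%E = (a < u%:E)%E.
  case: a => [r /side h|_|_]; first by rewrite !lte_fin h.
  - by rewrite !ltNge !leey.
  - by rewrite !ltNyr.
have sider (a : \bar R) : fine a \in s -> (v%:E < a)%E = (u%:E < a)%E.
  case: a => [r /side h|_|_]; first by rewrite !lte_fin h.
  - by rewrite !ltry.
  - by rewrite !ltNge !leNye.
have ends ab : ab \in itvs ->
    ((ab.1 < v%:E)%E = (ab.1 < u%:E)%E) * ((v%:E < ab.2)%E = (u%:E < ab.2)%E).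
  move=> abi; split; [apply: sidel|apply: sider]; rewrite !mem_cat.
    by rewrite (map_f (fun ab => fine ab.1) abi) orbT.
  by rewrite (map_f (fun ab => fine ab.2) abi) !orbT.
have inA t : A t <-> t \in pts \/
    exists2 ab, ab \in itvs & (ab.1 < t%:E)%E /\ (t%:E < ab.2)%E.
  by rewrite -[A t]/((A : set R) t) HA; split=> -[]; [left|right|left|right].
have up : u \notin pts by apply/negP => up; apply: us; rewrite mem_cat up.
have vp : v \notin pts.
  by apply/negP => vp; have := side v; rewrite mem_cat vp eqxx => /(_ isT)[].
rewrite !inA (negbTE up) (negbTE vp).
by split=> -[//|[ab abi h]]; right; exists ab => //; move: h; rewrite !(ends ab abi).
Qed.

(** Every point of [A] is then a jump. Together with the converse below, this makes finiteness of
    definable sets a first-order condition. *)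
Lemma finite_no_interval (A : R -> Prop) : defSet S A ->
  ~ (exists u v, u < v /\ forall t, u < t -> t < v -> A t) -> finite_set [set u | A u].
Proof.
move=> HA nA; apply: sub_finite_set (finite_jumps HA) => u Au eta eta0.
apply: contrapT => H; apply: nA; exists (u - eta), (u + eta); split; first lra.
move=> t t1 t2; apply: contrapT => nt; apply: H; exists t; split.
  by rewrite ltr_distl t1 t2.
by move=> [_ /(_ Au)].
Qed.

Lemma finite_has_no_interval (A : R -> Prop) : finite_set [set u | A u] ->
  ~ (exists u v, u < v /\ forall t, u < t -> t < v -> A t).
Proof.
move=> /finite_set_countable HA [u [v [uv H]]].
have [t [t1 [t2]]] := interval_escapes_countable HA uv.
by apply; exact: H.
Qed.

Lemma defPred_all_seq (V : Type) (I : eqType) (s : seq I) (P : I -> (V -> R) -> Prop) :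
  (forall i, defPred S (P i)) -> defPred S (fun e => forall i, i \in s -> P i e).
Proof.
move=> HP; elim: s => [|i s IH].
  by apply: (defPred_iff _ (defPred_true S 0 V)).
apply: (defPred_iff _ (defPred_and (HP i) IH)) => e; split.
  by move=> [Pi Ps] j; rewrite inE => /orP[/eqP->|/Ps].
by move=> H; split=> [|j js]; apply: H; rewrite inE ?eqxx ?js ?orbT.
Qed.

Lemma defPred_ex_seq (V : Type) (I : eqType) (s : seq I) (P : I -> (V -> R) -> Prop) :
  (forall i, defPred S (P i)) -> defPred S (fun e => exists i, i \in s /\ P i e).
Proof.
move=> HP; elim: s => [|i s IH].
  by apply: (defPred_iff _ (defPred_false S 0 V)) => e; split=> // -[i []].
apply: (defPred_iff _ (defPred_or (HP i) IH)) => e; split.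
  move=> [Pi|[j [js Pj]]]; first by exists i; rewrite mem_head.
  by exists j; rewrite inE js orbT.
by move=> [j []]; rewrite inE => /orP[/eqP->|js] Pj; [left|right; exists j].
Qed.

(* A first-order condition forcing the fibres over x and x' to be equipotent,
   whatever their cardinality. *)
Definition matched (Y : R -> R -> Prop) (eps x x' : R) : Prop :=
  (forall y, Y x y -> exists y', Y x' y' /\ `|y - y'| < 2 * eps) /\
  (forall y, Y x' y -> exists y', Y x y' /\ `|y - y'| < 2 * eps) /\
  (forall y z, Y x y -> Y x z -> y <> z -> 4 * eps <= `|y - z|) /\
  (forall y z, Y x' y -> Y x' z -> y <> z -> 4 * eps <= `|y - z|).

Definition stable (Y : R -> R -> Prop) (x : R) : Prop :=
  exists eps, 0 < eps /\ exists eta, 0 < eta /\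
    forall x', `|x' - x| < eta -> matched Y eps x x'.

Local Open Scope card_scope.

(** Points at distance [4 * eps] cannot share a partner within [2 * eps], so choosing partners is
    injective. *)
Lemma matched_card_le Y eps x x' : matched Y eps x x' ->
  [set y | Y x y] #<= [set y | Y x' y].
Proof.
move=> [H1 [_ [sep _]]].
have /choice[f Hf] : forall y, exists y', Y x y -> Y x' y' /\ `|y - y'| < 2 * eps.
  move=> y; have [Yy|nY] := pselect (Y x y); last by exists y.
  by have [y' Hy'] := H1 y Yy; exists y'.
rewrite -(card_le_eql (@inj_card_eq _ _ _ f _)).
  by apply: subset_card_le => _ [y /Hf[Yf _] <-].
move=> y z /set_mem Yy /set_mem Yz fyz; apply: contrapT => yz.
have := sep y z Yy Yz yz; rewrite leNgt => /negP; apply.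
have [_ h1] := Hf y Yy; have [_ h2] := Hf z Yz.
by have := ler_distD (f y) y z; rewrite {2}fyz (distrC (f z) z); lra.
Qed.

Lemma matched_sym Y eps x x' : matched Y eps x x' -> matched Y eps x' x.
Proof. by move=> [H1 [H2 [H3 H4]]]. Qed.

Lemma stable_dense (Y : R -> R -> Prop) (u v : R) : defRel S Y ->
  (forall x, finite_set [set y | Y x y]) -> u < v ->
  exists x, u < x /\ x < v /\ stable Y x.
Proof.
move=> HY Yfin uv.
(* [Fr] is a finite list of rationals approximating the fibre, with a rational precision at which
   the fibre is well separated. There are only countably many such data. *)
pose Q (Fr : seq rat * rat) (x : R) : Prop :=
  (forall q, q \in Fr.1 -> exists y, Y x y /\ `|y - ratr q| < ratr Fr.2) /\
  ((forall y, Y x y -> exists q, q \in Fr.1 /\ `|y - ratr q| < ratr Fr.2) /\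
  (forall y z, Y x y -> Y x z -> y <> z -> 4 * ratr Fr.2 <= `|y - z|)).
have HQ Fr : defSet S (Q Fr).
  rewrite /defSet /Q; apply: defPred_and.
    by apply: defPred_all_seq => q; def_auto.
  apply: defPred_and; last by def_auto.
  apply: (defPred_all 0); apply: defPred_imp; first by def_auto.
  by apply: defPred_ex_seq => q; def_auto.
(* Outside the countably many jumps of the sets Q Fr, every x is stable. *)
have jc : countable (\bigcup_(Fr in [set: seq rat * rat]) [set x | jump (Q Fr) x]).
  apply: bigcup_countable => // Fr _.
  exact: finite_set_countable (finite_jumps (HQ Fr)).
have [x [ux [xv nj]]] := interval_escapes_countable jc uv.
exists x; split=> //; split=> //.
have [d d0 dsep] := finite_separated (Yfin x).
have d40 : 0 < d / 4 by lra.
have [r] := rat_in_itvoo d40; rewrite in_itv /= => /andP[r0 rd].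
have /choice[g Hg] : forall y : R, exists q : rat, `|y - ratr q| < ratr r :> R.
  move=> y; have [|q] := @rat_in_itvoo R (y - ratr r) (y + ratr r); first lra.
  by rewrite in_itv /= -ltr_distl distrC => ?; exists q.
have [s Hs] := (finite_seqP _).1 (Yfin x).
have sY y : y \in s <-> Y x y by rewrite -[Y x y]/([set y | Y x y] y) Hs.
pose Fr := ([seq g y | y <- s], r).
have Qx : Q Fr x.
  split; first by move=> q /mapP[y /sY Yy ->]; exists y.
  split; first by move=> y /sY ys; exists (g y); split=> //; exact: map_f.
  move=> y z Yy Yz yz /=; have := dsep y z Yy Yz yz; lra.
have [eta eta0 Heta] : exists2 eta : R, 0 < eta &
    forall x', `|x' - x| < eta -> (Q Fr x' <-> Q Fr x).
  by apply: not_jump => j; apply: nj; exists Fr.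
exists (ratr r); split=> //; exists eta; split=> // x' /Heta[_ /(_ Qx)] Qx'.
have half x1 x2 : Q Fr x1 -> Q Fr x2 -> forall y, Y x1 y ->
    exists y', Y x2 y' /\ `|y - y'| < 2 * ratr r.
  move=> [_ [h1 _]] [h2 _] y /h1[q [qF yq]]; have [y' [Yy' y'q]] := h2 q qF.
  exists y'; split=> //; have := ler_distD (ratr q) y y'.
  by rewrite (distrC (ratr q) y') /= in yq y'q *; lra.
by split; [exact: half|split; [exact: half|case: Qx Qx' => _ [_ ?] [_ [_ ?]]]].
Qed.

(* A finite set meeting every connected component of the complement of the
   finite set A. *)
Definition sample (A : R -> Prop) (s : R) : Prop :=
  s = 0 \/ (A s \/ ((exists u v, A u /\ (A v /\ 2 * s = u + v)) \/
  (exists u, A u /\ (s = u + 1 \/ s = u - 1)))).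

Lemma finite_sample (A : R -> Prop) :
  finite_set [set u | A u] -> finite_set [set s | sample A s].
Proof.
move=> HA; apply: (@sub_finite_set _ _ ([set 0] `|` ([set u | A u] `|`
   ((\bigcup_(u in [set u | A u]) ((fun v => (u + v) / 2) @` [set v | A v])) `|`
    (((fun u => u + 1) @` [set u | A u]) `|` ((fun u => u - 1) @` [set u | A u])))))).
  move=> s [->|[As|[[u [v [Au [Av E]]]]|[u [Au [->|->]]]]]].
  - by left.
  - by right; left.
  - right; right; left; exists u => //; exists v => //; lra.
  - by right; right; right; left; exists u.
  - by right; right; right; right; exists u.
rewrite !finite_setU; split; first exact: finite_set1.
split=> //; split; last by split; apply: finite_image.
by apply: bigcup_finite => // u _; exact: finite_image.
Qed.

Lemma sample_component (A : R -> Prop) (x : R) : finite_set [set u | A u] ->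
  exists2 s, sample A s &
    s = x \/ forall t, (x <= t /\ t <= s) \/ (s <= t /\ t <= x) -> ~ A t.
Proof.
move=> HA; have [Ax|nAx] := pselect (A x); first by exists x; [right; left|left].
have below : (exists2 u, A u /\ u < x & forall w, A w -> w < x -> w <= u) \/
    forall w, A w -> ~ w < x.
  have [E|/set0P N] := eqVneq [set u | A u /\ u < x] set0.
    by right=> w Aw wx; have : [set u | A u /\ u < x] w by []; rewrite E.
  left; have [||||u [Au ux] Hu] := finite_least (sub_finite_set _ HA) N
    (le := fun y z => z <= y); first by move=> u [].
  - by [].
  - by move=> a b c _ _ _ /[swap]; exact: le_trans.
  - by move=> a b _ _; have [|/ltW] := leP a b; [right|left].
  by exists u => // w Aw wx; exact: Hu.
have above : (exists2 u, A u /\ x < u & forall w, A w -> x < w -> u <= w) \/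
    forall w, A w -> ~ x < w.
  have [E|/set0P N] := eqVneq [set u | A u /\ x < u] set0.
    by right=> w Aw wx; have : [set u | A u /\ x < u] w by []; rewrite E.
  left; have [||||u [Au ux] Hu] := finite_least (sub_finite_set _ HA) N
    (le := fun y z => y <= z); first by move=> u [].
  - by [].
  - by move=> a b c _ _ _; exact: le_trans.
  - by move=> a b _ _; have [|/ltW] := leP a b; [left|right].
  by exists u => // w Aw wx; exact: Hu.
have neq t : A t -> t != x by move=> At; apply/eqP => tx; apply: nAx; rewrite -tx.
have cmp t : A t -> t < x \/ x < t.
  by move=> /neq; rewrite neq_lt => /orP[]; [left|right].
case: below => [[u [Au ux] Hu]|Hu]; case: above => [[v [Av xv] Hv]|Hv].
- exists ((u + v) / 2); first by right; right; left; exists u, v; split=> //; split=> //; lra.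
  right=> t Ht At; case: (cmp t At) => [/(Hu t At)|/(Hv t At)]; lra.
- exists (u + 1); first by right; right; right; exists u; split=> //; left.
  right=> t Ht At; case: (cmp t At) => [/(Hu t At)|/(Hv t At)//]; lra.
- exists (v - 1); first by right; right; right; exists v; split=> //; right.
  right=> t Ht At; case: (cmp t At) => [/(Hu t At)//|/(Hv t At)]; lra.
- exists 0; first by left.
  by right=> t Ht At; case: (cmp t At) => [/(Hu t At)|/(Hv t At)].
Qed.

End OMinimal.

(** * Substitution of variables and constants in definable predicates *)

Section Projections.
Variables (L : language) (M : Type) (S : structure L M).

Lemma defPred_proj (V W : Type) (P : (V -> M) -> Prop) (h : (W -> M) -> V -> M) :
  (forall i, (exists j, forall e, h e i = e j) \/ (exists c, forall e, h e i = c)) ->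
  defPred S P -> defPred S (fun e => P (h e)).
Proof.
move=> Hh; have /choice[g Hg] : forall i, exists g : W + M,
    forall e, h e i = match g with inl j => e j | inr c => c end.
  by move=> i; case: (Hh i) => [[j Hj]|[c Hc]]; [exists (inl j)|exists (inr c)].
move=> /(defPred_rename g); apply: defPred_iff => e.
rewrite (_ : h e = (fun i => match g i with inl j => e j | inr c => c end)) //.
by apply: funext => i; exact: Hg.
Qed.

End Projections.

(** * Uniform finiteness *)

Section UniformFiniteness.
Variables (R : realType) (L : language) (S : structure L R).
Hypotheses (Sf : defField S) (Somin : o_minimal S).
Local Open Scope card_scope.

(* The fibre over x is {y | Q x y z}, the sequence z being a parameter. *)
Section Step.
Variable Q : R -> R -> (nat -> R) -> Prop.
Hypotheses (HQ : defPred S (fun e : option (option nat) -> R =>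
    Q (e None) (e (Some None)) (fun k => e (Some (Some k)))))
  (Qfin : forall x z, finite_set [set y | Q x y z]).

Lemma defPred_app_family (V : Type) (f g : (V -> R) -> R) (h : nat -> V) :
  defFun S f -> defFun S g -> defPred S (fun e => Q (f e) (g e) (fun k => e (h k))).
Proof.
move=> Hf Hg.
apply: (@defPred_iff _ _ _ _ (fun e => exists a, a = f e /\
    exists b, b = g e /\ Q a b (fun k => e (h k)))).
  by move=> e; split=> [[a [-> [b [->]]]]|H] //; exists (f e); split=> //; exists (g e).
apply: (defPred_ex 0); apply: defPred_and; first exact: Hf.
apply: (defPred_ex 0); apply: defPred_and; first exact: (defFun_vars Some Hg).
exact: (defPred_vars (fun o => match o with None => Some None | Some None => None
  | Some (Some k) => Some (Some (h k)) end) HQ).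
Qed.

Lemma defRel_family z : defRel S (fun x y => Q x y z).
Proof.
rewrite /defRel; move: HQ.
apply: (defPred_proj (h := fun (e : bool -> R) o => match o with None => e true
  | Some None => e false | Some (Some k) => z k end)).
by move=> [[k|]|]; [right; exists (z k)|left; exists false|left; exists true].
Qed.

Ltac family_step := first [def_step | cbv beta;
  match goal with |- defPred _ (fun e => Q (@?f e) (@?g e) _) =>
    apply: (defPred_app_family (f := f) (g := g)) end].

(** Instability is definable, and by density of the stable points it holds on no interval. *)
Lemma finite_unstable z :
  finite_set [set x | ~ stable (fun x y => Q x y z) x].
Proof.
have H : defSet S (fun x => ~ stable (fun x y => Q x y z) x).
  move: (defRel_family z); move: (fun x y => Q x y z) => Y HY.
  by rewrite /defSet /stable /matched; def_auto.
apply: (finite_no_interval Somin H) => -[u [v [uv Huv]]].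
have [x [ux [xv]]] := stable_dense Sf Somin (defRel_family z) (Qfin ^~ z) uv.
exact: Huv.
Qed.

(** Unless [s = x], the segment from [x] to [s] consists of stable points, and the cardinality of
    the fibre is constant along it. *)
Lemma unstable_sample_bound x z : exists2 s,
  sample (fun x => ~ stable (fun x y => Q x y z) x) s &
  forall N, [set y | Q s y z] #<= `I_N -> [set y | Q x y z] #<= `I_N.
Proof.
have [s samp Hs] := sample_component x (finite_unstable z).
exists s => //; case: Hs => [->//|Hs].
pose P (t t' : R) := forall N, [set y | Q t y z] #<= `I_N <-> [set y | Q t' y z] #<= `I_N.
have Ptr a b c : P a b -> P b c -> P a c by move=> ab bc N; rewrite ab.
have Psym a b : P a b -> P b a by move=> ab N; rewrite ab.
have Ploc (t : R) : stable (fun x y => Q x y z) t ->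
    exists2 eta : R, 0 < eta & forall t' : R, `|t' - t| < eta -> P t t'.
  move=> [eps [_ [eta [eta0 H]]]]; exists eta => // t' /H Ht N; split.
    exact: card_le_trans (matched_card_le (matched_sym Ht)).
  exact: card_le_trans (matched_card_le Ht).
suff Psx : P s x by move=> N; exact: (Psx N).1.
have [xs|sx] := leP x s.
  apply: (Psym).
  apply: (locally_constant_const Ptr Psym) => // t xt ts; apply: Ploc.
  by apply: contrapT; apply: Hs; left.
apply: (locally_constant_const Ptr Psym) => //; last exact: ltW.
move=> t st tx; apply: Ploc.
by apply: contrapT; apply: Hs; right.
Qed.

(** The union of the fibres over the sample points no longer depends on [x]: it is the family with
    one parameter less used in the induction. *)
Lemma defPred_samples : defPred S (fun e : option nat -> R => exists s,
  sample (fun x => ~ stable (fun x y => Q x y (fun k => e (Some k))) x) s /\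
  Q s (e None) (fun k => e (Some k))).
Proof.
have H V (f : (V -> R) -> R) (h : nat -> V) : defFun S f -> defPred S (fun e : V -> R =>
    stable (fun x y => Q x y (fun k => e (h k))) (f e)).
  by move=> Hf; rewrite /stable /matched; repeat family_step.
rewrite /sample; repeat first [family_step | apply: H].
Qed.

Lemma finite_samples z : finite_set [set y | exists s,
  sample (fun x => ~ stable (fun x y => Q x y z) x) s /\ Q s y z].
Proof.
apply: (@sub_finite_set _ _ (\bigcup_(s in [set s |
    sample (fun x => ~ stable (fun x y => Q x y z) x) s]) [set y | Q s y z])).
  by move=> y [s [Hs Qs]]; exists s.
by apply: bigcup_finite => //; exact: finite_sample (finite_unstable z).
Qed.

End Step.

Lemma env_consE (e : nat -> R) : e = env_cons (e 0%N) (fun k => e k.+1).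
Proof. by apply: funext => -[]. Qed.

(** Here [n] counts the parameters allowed to be nonzero. The first of them is [x]; the induction
    hypothesis bounds the union [W] of the fibres over the sample points, hence the fibre over every
    [x]. *)
Lemma uniform_finiteness_nat n (P : (nat -> R) -> Prop) : defPred S P ->
  exists N, forall e, (forall k, (n <= k)%N -> e k = 0) ->
    finite_set [set a | P (env_cons a e)] -> [set a | P (env_cons a e)] #<= `I_N.
Proof.
elim: n P => [|n IH] P HP.
  have [[N HN]|nf] := pselect (exists N, [set a | P (env_cons a (fun _ => 0))] #<= `I_N).
    exists N => e e0 _; suff -> : e = (fun _ => 0) by [].
    by apply: funext => k; exact: e0.
  exists 0%N => e e0; suff -> : e = (fun _ => 0).
    by move=> /finite_set_leP /nf.
  by apply: funext => k; exact: e0.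
pose itv x z := exists u v : R, u < v /\
  forall t, u < t -> t < v -> P (env_cons t (env_cons x z)).
(* Fibres containing an interval are emptied, so that every fibre of [Q] is finite. *)
pose Q x y z := P (env_cons y (env_cons x z)) /\ ~ itv x z.
have HPV V (i j : V) (h : nat -> V) : defPred S (fun e : V -> R =>
    P (env_cons (e i) (env_cons (e j) (fun k => e (h k))))).
  apply: (defPred_proj (h := fun e => env_cons (e i) (env_cons (e j) (fun k => e (h k))))) => //.
  by move=> [|[|k]]; left; [exists i|exists j|exists (h k)].
have HQ : defPred S (fun e : option (option nat) -> R =>
    Q (e None) (e (Some None)) (fun k => e (Some (Some k)))).
  by rewrite /Q /itv; repeat first [def_step | apply: HPV].
have Qfin x z : finite_set [set y | Q x y z].
  have [Hi|Hi] := pselect (itv x z).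
    by rewrite (_ : [set y | _] = set0) //; apply/seteqP; split=> // y [].
  apply: sub_finite_set (finite_no_interval Somin _ Hi); first by move=> y [].
  apply: (defPred_proj (h := fun e : unit -> R => env_cons (e tt) (env_cons x z))) => //.
  move=> [|k]; first by left; exists tt.
  by right; exists (env_cons x z k).
have HW := defPred_samples HQ.
pose W e := exists s, sample (fun x => ~ stable (fun x y => Q x y (fun k => e k.+1)) x) s /\
  Q s (e 0%N) (fun k => e k.+1).
have {}HW : defPred S W.
  exact: (defPred_vars (fun o => if o is Some k then k.+1 else 0%N) HW).
have [N HN] := IH W HW; exists N => e e0 efin.
rewrite (env_consE e) in efin *.
set x := e 0%N in efin *; set z := (fun k => e k.+1) in efin *.
have PQ y : P (env_cons y (env_cons x z)) <-> Q x y z.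
  by split=> [Py|[]//]; split=> //; exact: finite_has_no_interval.
have [s samp Hs] := unstable_sample_bound HQ Qfin x z.
rewrite (_ : [set a | _] = [set y | Q x y z]); last first.
  by apply/predeqP => y; exact: PQ.
apply: Hs; apply: card_le_trans (HN z _ _).
- by apply: subset_card_le => y Qy; exists s.
- by move=> k nk; exact: e0.
- exact: (finite_samples HQ Qfin z).
Qed.

Lemma uniform_finiteness (V : Type) (P : (option V -> R) -> Prop) : defPred S P ->
  exists N, forall e : V -> R, finite_set [set a | P (opt_cons a e)] ->
    [set a | P (opt_cons a e)] #<= `I_N.
Proof.
move=> /(defPred_opt_nat 0)[P' [h [HP' PP']]].
have [B HB] := defPred_finite_support HP'.
(* The entries of [h e] from [B] on do not matter; putting them to 0 leaves [B] parameters. *)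
have [N HN] := uniform_finiteness_nat B HP'.
exists N => e; pose e' k := if (k < B)%N then h e k else 0.
rewrite (_ : [set a | _] = [set a | P' (env_cons a e')]).
  by apply: HN => k Bk; rewrite /e' ltnNge Bk.
apply/predeqP => a /=; rewrite PP'; apply: HB => -[|k] //= kB.
by rewrite /e' (ltnW kB).
Qed.

End UniformFiniteness.

(** * Locating a real by the number of jumps below it *)

Section Counting.
Variables (R : realType).
Implicit Types (A B : R -> Prop).
Local Open Scope card_scope.

(** Counts elements of [A] smaller than [a] along a descending chain, which is first-order for each
    fixed [i]. *)
Fixpoint at_least A (i : nat) (a : R) : Prop :=
  if i is j.+1 then exists u, u < a /\ (A u /\ at_least A j u) else True.

Definition exactly A (i : nat) (a : R) : Prop := at_least A i a /\ ~ at_least A i.+1 a.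

Lemma at_least_le A i a b : a <= b -> at_least A i a -> at_least A i b.
Proof.
by case: i => //= i ab [u [ua Hu]]; exists u; split=> //; exact: lt_le_trans ab.
Qed.

Lemma at_least_leq A i j a : (j <= i)%N -> at_least A i a -> at_least A j a.
Proof.
elim: i j a => [|i IH] j a; first by rewrite leqn0 => /eqP->.
case: j => // j ji /= [u [ua [Au Hu]]]; exists u; split=> //; split=> //.
exact: IH.
Qed.

Lemma at_least_succ A i a b : A a -> a < b -> at_least A i a -> at_least A i.+1 b.
Proof. by move=> Aa ab Ha; exists a. Qed.

Lemma at_least_seq A i a : at_least A i a ->
  exists s : seq R, [/\ size s = i, uniq s & forall x, x \in s -> A x /\ x < a].
Proof.
elim: i a => [|i IH] a /=; first by exists [::].
move=> [u [ua [Au /IH[s [si us Hs]]]]]; exists (u :: s); split=> /=.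
- by rewrite si.
- by rewrite us andbT; apply/negP => /Hs[_]; rewrite ltxx.
- move=> x; rewrite inE => /orP[/eqP->//|/Hs[Ax xu]]; split=> //.
  exact: lt_trans ua.
Qed.

Lemma at_least_card A N a : [set u | A u] #<= `I_N -> ~ at_least A N.+1 a.
Proof.
move=> HN /at_least_seq[s [sN us Hs]].
have Afin : finite_set [set u | A u] by apply/finite_set_leP; exists N.
have := geq_card_fset_set HN; rewrite leqNgt => /negP; apply.
rewrite -sN; apply: uniq_leq_size => // x /Hs[Ax _].
by rewrite in_fset_set // inE.
Qed.

Lemma exactly_exists A N a : ~ at_least A N.+1 a ->
  exists i, (i < N.+1)%N /\ exactly A i a.
Proof.
elim: N => [|N IH] H; first by exists 0%N.
have [HN|/IH[i [iN Hi]]] := pselect (at_least A N.+1 a).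
  by exists N.+1.
by exists i; split=> //; exact: ltnW.
Qed.

Lemma exactly_lt A i j a b : A a -> a < b -> exactly A i a -> exactly A j b -> (i < j)%N.
Proof.
move=> Aa ab [Hi _] [_ nHj]; rewrite ltnNge; apply/negP => ji; apply: nHj.
by apply: (@at_least_leq _ i.+1) => //; exact: at_least_succ Hi.
Qed.

Lemma exactly_inj A i a b : A a -> A b -> exactly A i a -> exactly A i b -> a = b.
Proof.
move=> Aa Ab Ha Hb; have [ab|ba|//] := ltgtP a b.
  by have := exactly_lt Aa ab Ha Hb; rewrite ltnn.
by have := exactly_lt Ab ba Hb Ha; rewrite ltnn.
Qed.

(** Membership in [B] depends only on the position among the jumps: for [a < b] with equally many
    jumps below, [a] cannot be a jump, hence neither can [b], and the segment between them has
    none. *)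
Lemma exactly_jump_const B i a b : exactly (jump B) i a -> exactly (jump B) i b ->
  (jump B a <-> jump B b) -> (B a <-> B b).
Proof.
wlog ab : a b / a < b => [H Ha Hb Hab|Ha Hb Hab].
  have [ab|ba|->//] := ltgtP a b; first exact: H.
  by rewrite (H b a ba Hb Ha) //; rewrite Hab.
have nj u : a <= u -> u < b -> ~ jump B u.
  move=> au ub ju; have := exactly_lt ju ub (i := i) _ Hb; rewrite ltnn => H.
  suff : false by []; apply: H; split; first by apply: at_least_le au _; case: Ha.
  move=> H; case: Hb => _; apply; apply: at_least_le H; exact: ltW.
apply: no_jump_const => [|u au]; first exact: ltW.
rewrite le_eqVlt => /orP[/eqP->|ub]; last exact: nj.
by rewrite -Hab; exact: nj.
Qed.

End Counting.

(** * Transfer of a cut along an order-preserving correspondence *)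

Section Correspondence.
Variables (R : realType) (D : R -> Prop) (sc : R -> R).
Hypothesis sc_small : forall eps : R, 0 < eps -> exists w, D w /\ 0 < sc w /\ sc w < eps.

(* The cut of a in the domain of the correspondence E has a realized counterpart
   in its codomain: the comparisons with sc tell a gap of positive length from a
   cut with a single real number, the common limit of both sides. *)
Lemma transfer_cut (E : R -> R -> Prop) (a : R) :
  (forall u v, E u v -> u <> a) ->
  (forall u v u' v', E u v -> E u' v' -> u < u' -> v < v') ->
  (forall u v u' v' w, D w -> E u v -> E u' v' -> u + sc w < u' -> v + sc w < v') ->
  (forall u v w, D w -> E u v -> u * sc w < 1 -> v * sc w < 1) ->
  (forall u v w, D w -> E u v -> -1 < u * sc w -> -1 < v * sc w) ->
  exists b, forall u v, E u v -> (u < a -> v < b) /\ (a < u -> b < v).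
Proof.
move=> nE E1 E2 E3 E4.
have cmp u v : E u v -> u < a \/ a < u.
  by move=> /nE/eqP; rewrite neq_lt => /orP[]; [left|right].
have a10 : 0 < `|a| + 1 by have := normr_ge0 a; lra.
(* At this scale [|a| * sc w < 1], so [(sc w)^-1] and its opposite can serve as [b] when the whole
   domain lies on one side of [a]. *)
have [w [Dw [w0 wa]]] := sc_small (divr_gt0 ltr01 a10).
have wa1 : sc w * (`|a| + 1) < 1 by rewrite -ltr_pdivlMr.
have wale : sc w * `|a| < 1 by lra.
have aw : a * sc w < 1.
  by apply: le_lt_trans wale; rewrite mulrC ler_pM2l // ler_norm.
have aw' : -1 < a * sc w.
  have : sc w * - a <= sc w * `|a| by rewrite ler_pM2l // -normrN ler_norm.
  lra.
have [[u1 [v1 [E1' u1a]]]|noup] := pselect (exists u v, E u v /\ a < u); last first.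
  exists (sc w)^-1 => u v Euv; split=> h; last by case: noup; exists u, v.
  rewrite -[ltRHS]mul1r ltr_pdivlMr //.
  apply: E3 Euv _ => //; apply: lt_trans aw; by rewrite ltr_pM2r.
have [[u0 [v0 [E0 u0a]]]|nolow] := pselect (exists u v, E u v /\ u < a); last first.
  exists (- (sc w)^-1) => u v Euv; split=> h; first by case: nolow; exists u, v.
  rewrite -[X in - X]mul1r -mulNr ltr_pdivrMr //.
  apply: E4 Euv _ => //; apply: lt_trans aw' _; by rewrite ltr_pM2r.
pose low := [set v | exists u, E u v /\ u < a].
have lowS : has_sup low.
  split; first by exists v0, u0.
  by exists v1 => v [u [Euv ua]]; apply/ltW/(E1 u v u1 v1) => //; exact: lt_trans u1a.
have suplow v : low v -> v <= sup low by move=> lv; apply: ub_le_sup => //; case: lowS.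
have lesup t : (forall v, low v -> v <= t) -> sup low <= t.
  by move=> H; apply: ge_sup => //; case: lowS.
have [[w' [Dw' [w'0 gap]]]|nogap] := pselect (exists w, D w /\ 0 < sc w /\
    forall u v u' v', E u v -> u < a -> E u' v' -> a < u' -> u + sc w < u').
  (* The gap of length [sc w'] around [a] reappears in the codomain, above [sup low]; its middle is
     strictly inside. *)
  exists (sup low + sc w' / 2) => u v Euv; split=> h.
    by have : v <= sup low; [apply: suplow; exists u|lra].
  have : sup low <= v - sc w'.
    apply: lesup => v' [u' [Euv' u'a]].
    have : v' + sc w' < v by apply: (E2 u' v' u v) => //; exact: (gap u' v' u v).
    lra.
  lra.
have close (eta : R) : 0 < eta -> exists u v u' v',
    E u v /\ (u < a /\ (E u' v' /\ (a < u' /\ u' - u < eta))).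
  move=> /sc_small[w' [Dw' [w'0 w'e]]]; apply: contrapT => H.
  apply: nogap; exists w'; split=> //; split=> // u v u' v' Euv ua Euv' u'a.
  rewrite ltNge; apply/negP => h; apply: H; exists u, v, u', v'.
  by do 4!split=> //; lra.
(* The domain now accumulates at [a] from both sides, so between [u] and [a] there is another point
   of it; this makes the inequalities with [sup low] strict. *)
exists (sup low) => u v Euv; split=> h.
  have [|u2 [v2 [u2' [v2' [Eu2 [u2a [Eu2' [u2'a u2d]]]]]]]] := close (a - u); first lra.
  have vv2 : v < v2 by apply: (E1 u v u2 v2) => //; lra.
  by apply: lt_le_trans vv2 _; apply: suplow; exists u2.
have [|u2 [v2 [u2' [v2' [Eu2 [u2a [Eu2' [u2'a u2d]]]]]]]] := close (u - a); first lra.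
have vv2 : v2' < v by apply: (E1 u2' v2' u v) => //; lra.
apply: le_lt_trans vv2; apply: lesup => v' [u' [Euv' u'a]].
by apply/ltW/(E1 u' v' u2' v2') => //; exact: lt_trans u2'a.
Qed.

End Correspondence.

(** * Traces over D and the elimination of a quantifier *)

Section Traces.
Variables (R : realType) (L : language) (S : structure L R) (D : R -> Prop).
Hypotheses (Sf : defField S) (Somin : o_minimal S).
Local Open Scope card_scope.

(* In trace relations theta d x, the sequence d stands for a tuple of elements
   of D, and x for the tuple of real arguments. *)
Definition defTrace (theta : (nat -> R) -> (nat -> R) -> Prop) : Prop :=
  defPred S (fun e : nat + nat -> R => theta (fun n => e (inl n)) (fun n => e (inr n))).

Definition defTrace1 (T : R -> (nat -> R) -> (nat -> R) -> Prop) : Prop :=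
  defPred S (fun e : option (nat + nat) -> R =>
    T (e None) (fun n => e (Some (inl n))) (fun n => e (Some (inr n)))).

Lemma defTrace_app (V : Type) theta (g h : nat -> V) : defTrace theta ->
  defPred S (fun e => theta (fun n => e (g n)) (fun n => e (h n))).
Proof.
exact: (@defPred_vars _ _ _ _ _ _ (fun o => match o with inl n => g n | inr n => h n end)).
Qed.

Lemma defTrace1_app (V : Type) T (f : (V -> R) -> R) (g h : nat -> V) :
  defTrace1 T -> defFun S f ->
  defPred S (fun e => T (f e) (fun n => e (g n)) (fun n => e (h n))).
Proof.
move=> HT Hf; apply: (@defPred_iff _ _ _ _ (fun e => exists a, a = f e /\
    T a (fun n => e (g n)) (fun n => e (h n)))).
  by move=> e; split=> [[a [->]]|] //; exists (f e).
apply: (defPred_ex 0); apply: defPred_and; first exact: Hf.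
exact: (defPred_vars (fun o => match o with None => None
  | Some (inl n) => Some (g n) | Some (inr n) => Some (h n) end) HT).
Qed.

Ltac trace_step := first [def_step | cbv beta; match goal with
  | H : defTrace1 ?T |- defPred _ (fun e => ?T (@?f e) _ _) =>
      apply: (defTrace1_app _ _ H)
  | H : forall i, defTrace1 (?T i) |- defPred _ (fun e => ?T ?i (@?f e) _ _) =>
      apply: (defTrace1_app _ _ (H i))
  | H : defTrace ?T |- defPred _ (fun e => ?T _ _) => apply: (defTrace_app _ _ H)
  end].
Ltac trace_auto := repeat trace_step.

Definition same_trace (theta : (nat -> R) -> (nat -> R) -> Prop) (x y : nat -> R) : Prop :=
  forall d, (forall n, D (d n)) -> (theta d x <-> theta d y).

Definition trace_bounded (E : (nat -> R) -> (nat -> R) -> Prop) : Prop :=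
  exists theta, defTrace theta /\ forall x y, same_trace theta x y -> E x y.

Lemma trace_bounded_sub (E E' : (nat -> R) -> (nat -> R) -> Prop) :
  (forall x y, E x y -> E' x y) -> trace_bounded E -> trace_bounded E'.
Proof. by move=> EE' [th [Hth HE]]; exists th; split=> // x y /HE/EE'. Qed.

Lemma trace_bounded_same theta : defTrace theta -> trace_bounded (same_trace theta).
Proof. by exists theta. Qed.

Variables (d0 d1 : R).
Hypotheses (Dd0 : D d0) (Dd1 : D d1) (d01 : d0 <> d1).

(* Whether the first two entries of d agree selects one of the two relations. *)
Lemma trace_bounded_and E1 E2 : trace_bounded E1 -> trace_bounded E2 ->
  trace_bounded (fun x y => E1 x y /\ E2 x y).
Proof.
move=> [th1 [Hth1 HE1]] [th2 [Hth2 HE2]].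
exists (fun d x => (d 0%N = d 1%N -> th1 (fun n => d n.+2) x) /\
  (d 0%N <> d 1%N -> th2 (fun n => d n.+2) x)); split.
  rewrite /defTrace; trace_auto.
move=> x y Hxy; split.
  apply: HE1 => d Hd; have [] := Hxy (env_cons d0 (env_cons d0 d)).
    by move=> [|[|n]] //=.
  move=> /= h1 h2; split=> h; [apply h1|apply h2] => //; by split.
apply: HE2 => d Hd; have [] := Hxy (env_cons d0 (env_cons d1 d)).
  by move=> [|[|n]] //=.
move=> /= h1 h2; split=> h; [apply h1|apply h2] => //; by split.
Qed.

Lemma trace_bounded_all n (E : nat -> (nat -> R) -> (nat -> R) -> Prop) :
  (forall i, trace_bounded (E i)) ->
  trace_bounded (fun x y => forall i, (i < n)%N -> E i x y).
Proof.
move=> HE; elim: n => [|n IH].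
  by apply: trace_bounded_sub (HE 0%N).
apply: trace_bounded_sub (trace_bounded_and IH (HE n)) => x y [H1 H2] i.
by rewrite ltnS leq_eqVlt => /orP[/eqP->|/H1].
Qed.

Variable sc : R -> R.
Hypotheses (Hsc : defRel S (fun s w => s = sc w))
  (sc_small : forall eps : R, 0 < eps -> exists w, D w /\ 0 < sc w /\ sc w < eps).

(** A trace relation has a single sequence of elements of [D] as argument; interleaving packs the
    two sequences needed to compare jumps of two different fibres. *)
Definition zip_seq (d d' : nat -> R) (n : nat) : R := if odd n then d' n./2 else d n./2.
Definition evens (d : nat -> R) : nat -> R := fun n => d n.*2.
Definition odds (d : nat -> R) : nat -> R := fun n => d n.*2.+1.

Lemma evens_zip d d' : evens (zip_seq d d') = d.
Proof. by apply: funext => n; rewrite /evens /zip_seq odd_double doubleK. Qed.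

Lemma odds_zip d d' : odds (zip_seq d d') = d'.
Proof.
by apply: funext => n; rewrite /odds /zip_seq /= odd_double /= uphalf_double.
Qed.

Lemma zip_D d d' : (forall n, D (d n)) -> (forall n, D (d' n)) ->
  forall n, D (zip_seq d d' n).
Proof. by move=> Hd Hd' n; rewrite /zip_seq; case: ifP. Qed.

Lemma env_cons_D w d : D w -> (forall n, D (d n)) -> forall n, D (env_cons w d n).
Proof. by move=> Dw Hd []. Qed.

Section BackAndForth.
Variable theta : (nat -> R) -> (nat -> R) -> Prop.
Hypothesis Htheta : defTrace theta.

Let fib d x : R -> Prop := fun a => theta d (env_cons a x).
Let G d x : R -> Prop := jump (fib d x).
Let rk k u d x := G d x u /\ exactly (G d x) k u.

Let Hfib : defTrace1 (fun a d x => fib d x a).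
Proof.
apply: (defPred_proj (h := fun (e : option (nat + nat) -> R) o => match o with
  | inl n => e (Some (inl n)) | inr 0%N => e None | inr n.+1 => e (Some (inr n)) end)) Htheta.
by move=> [n|[|n]]; left; [exists (Some (inl n))|exists None|exists (Some (inr n))].
Qed.

Let HG : defTrace1 (fun u d x => G d x u).
Proof.
have H : defTrace1 (fun a d x => fib d x a) := Hfib.
by rewrite /defTrace1 /G /jump; repeat first [trace_step | apply: (defTrace1_app _ _ H)].
Qed.

Let Hatl i : defTrace1 (fun u d x => at_least (G d x) i u).
Proof.
elim: i => [|i IH]; first exact: (defPred_true S 0).
by rewrite /defTrace1 /=; repeat first [def_step | apply: (defTrace1_app _ _ HG)
  | apply: (defTrace1_app _ _ IH)].
Qed.

Let Hex i : defTrace1 (fun u d x => exactly (G d x) i u).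
Proof.
apply: defPred_and; first exact: Hatl.
by apply: (defPred_not 0); exact: (Hatl i.+1).
Qed.

Let Hrk i : defTrace1 (fun u d x => rk i u d x).
Proof. by apply: defPred_and; [exact: HG|exact: Hex]. Qed.

Let Gbound : exists N, forall d x a, ~ at_least (G d x) N.+1 a.
Proof.
have [N HN] := uniform_finiteness Sf Somin HG.
exists N => d x a; apply: at_least_card.
have Hs : defSet S (fib d x).
  apply: (defPred_proj (h := fun (e : unit -> R) o => match o with
    | inl n => d n | inr n => env_cons (e tt) x n end)) Htheta.
  by move=> [n|[|n]]; [right; exists (d n)|left; exists tt|right; exists (x n)].
exact: (HN (fun o => match o with inl n => d n | inr n => x n end)
  (finite_jumps Somin Hs)).
Qed.

Ltac family_auto_step := first [def_step | apply: (defTrace1_app _ _ HG)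
  | apply: (defTrace1_app _ _ Hfib)
  | match goal with
    | |- defPred _ (fun e => exactly _ ?i _) => apply: (defTrace1_app _ _ (Hex i))
    | |- defPred _ (fun e => rk ?i _ _ _) => apply: (defTrace1_app _ _ (Hrk i))
    end].
Ltac family_auto := repeat family_auto_step.

Lemma trace_bounded_back_and_forth : trace_bounded (fun x y =>
  forall a, exists b, same_trace theta (env_cons a x) (env_cons b y)).
Proof.
have [N HN] := Gbound.
(* [t1] and [t2] record membership in a fibre at, and off, a jump with [i] jumps below. [t3] to [t6]
   place a jump of one fibre relative to those of another, [t6] measuring distances by [sc]. [t7]
   and [t8] bound a jump by inverse scales. *)
pose t1 i d x := exists a, exactly (G d x) i a /\ (G d x a /\ fib d x a).
pose t2 i d x := exists a, exactly (G d x) i a /\ (~ G d x a /\ fib d x a).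
pose t3 k i d x := exists u, rk k u (evens d) x /\ exactly (G (odds d) x) i u.
pose t4 k d x := exists u, rk k u (evens d) x /\ G (odds d) x u.
pose t5 k k' d x := exists u u', rk k u (evens d) x /\ (rk k' u' (odds d) x /\ u < u').
pose t6 k k' d x := exists u u', rk k u (evens (fun n => d n.+1)) x /\
  (rk k' u' (odds (fun n => d n.+1)) x /\ u + sc (d 0%N) < u').
pose t7 k d x := exists u, rk k u (fun n => d n.+1) x /\ u * sc (d 0%N) < 1.
pose t8 k d x := exists u, rk k u (fun n => d n.+1) x /\ -1 < u * sc (d 0%N).
have Dsc (V : Type) (i : V) : defFun S (fun e => sc (e i)).
  exact: (defFun_app1 0 Hsc (defFun_var S i)).
have HT1 i : defTrace (t1 i) by rewrite /defTrace /t1; family_auto.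
have HT2 i : defTrace (t2 i) by rewrite /defTrace /t2; family_auto.
have HT3 k i : defTrace (t3 k i) by rewrite /defTrace /t3 /evens /odds; family_auto.
have HT4 k : defTrace (t4 k) by rewrite /defTrace /t4 /evens /odds; family_auto.
have HT5 k k' : defTrace (t5 k k') by rewrite /defTrace /t5 /evens /odds; family_auto.
have HT6 k k' : defTrace (t6 k k').
  by rewrite /defTrace /t6 /evens /odds; repeat first [family_auto_step | apply: Dsc].
have HT7 k : defTrace (t7 k).
  by rewrite /defTrace /t7; repeat first [family_auto_step | apply: Dsc].
have HT8 k : defTrace (t8 k).
  by rewrite /defTrace /t8; repeat first [family_auto_step | apply: Dsc].
apply: trace_bounded_sub (trace_bounded_all N.+1 (fun i =>
  trace_bounded_and (trace_bounded_same (HT1 i))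
  (trace_bounded_and (trace_bounded_same (HT2 i))
  (trace_bounded_and (trace_bounded_same (HT4 i))
  (trace_bounded_and (trace_bounded_same (HT7 i))
  (trace_bounded_and (trace_bounded_same (HT8 i))
  (trace_bounded_all N.+1 (fun j =>
  trace_bounded_and (trace_bounded_same (HT3 i j))
  (trace_bounded_and (trace_bounded_same (HT5 i j))
    (trace_bounded_same (HT6 i j)))))))))))  => x y H a.
have exN d z u : exists i, (i < N.+1)%N /\ exactly (G d z) i u.
  exact: exactly_exists (HN d z u).
have rk_inj k d z u v : rk k u d z -> rk k v d z -> u = v.
  by move=> [Gu Eu] [Gv Ev]; exact: exactly_inj Eu Ev.
have rk_trace k d u : (k < N.+1)%N -> (forall n, D (d n)) ->
    rk k u d x -> exists v, rk k v d y.
  move=> kN Dd Hu; have [_ [_ [H4 _]]] := H k kN.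
  have [|v [Hv _]] := (H4 (zip_seq d d) (zip_D Dd Dd)).1.
    by exists u; rewrite evens_zip odds_zip; split=> //; case: Hu.
  by exists v; rewrite evens_zip in Hv.
have rk_trace' k d v : (k < N.+1)%N -> (forall n, D (d n)) ->
    rk k v d y -> exists u, rk k u d x.
  move=> kN Dd Hu; have [_ [_ [H4 _]]] := H k kN.
  have [|u [Hv _]] := (H4 (zip_seq d d) (zip_D Dd Dd)).2.
    by exists v; rewrite evens_zip odds_zip; split=> //; case: Hu.
  by exists u; rewrite evens_zip in Hv.
(* It is enough that [b] be placed among the jumps over [y] as [a] is among those over [x], for all
   tuples at once; [t1] and [t2] then transfer membership. *)
suff [b Hb] : exists b, forall d, (forall n, D (d n)) ->
    (forall i, (i < N.+1)%N -> exactly (G d x) i a -> exactly (G d y) i b) /\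
    (G d x a <-> G d y b).
  exists b => d Dd; have [Hex_ab HGab] := Hb d Dd.
  have [i [iN Ei]] := exN d x a; have Eib := Hex_ab i iN Ei.
  have [H1 [H2 _]] := H i iN.
  have move_ x1 x2 a1 a2 : (t1 i d x1 -> t1 i d x2) -> (t2 i d x1 -> t2 i d x2) ->
      exactly (G d x1) i a1 -> exactly (G d x2) i a2 -> (G d x1 a1 <-> G d x2 a2) ->
      fib d x1 a1 -> fib d x2 a2.
    move=> h1 h2 E1 E2 GG f1; have [g1|g1] := pselect (G d x1 a1).
      have [|a' [Ea' [Ga' fa']]] := h1; first by exists a1.
      by apply: (exactly_jump_const Ea' E2 _).1 => //; split=> // _; apply/GG.
    have [|a' [Ea' [Ga' fa']]] := h2; first by exists a1.
    by apply: (exactly_jump_const Ea' E2 _).1 => //; split=> [/Ga'|/GG].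
  have [h1 h1'] := H1 d Dd; have [h2 h2'] := H2 d Dd.
  split; first exact: move_ h1 h2 Ei Eib HGab.
  by apply: move_ h1' h2' Eib Ei _; rewrite HGab.
(* If [a] is a jump for some [d], the jump of the same rank over [y] is the only candidate for
   [b]. *)
have [[d [Dd Gda]]|nG] := pselect (exists d, (forall n, D (d n)) /\ G d x a).
  have [k [kN Ek]] := exN d x a; have Hka : rk k a d x by [].
  have [b Hb] := rk_trace k d a kN Dd Hka; exists b => d' Dd'; split.
    move=> i iN Ei; have [_ [_ [_ [_ [_ /(_ i iN)[H3 _]]]]]] := H k kN.
    have [|v [Hv Ev]] := (H3 (zip_seq d d') (zip_D Dd Dd')).1.
      by exists a; rewrite evens_zip odds_zip.
    rewrite evens_zip odds_zip in Hv Ev; by rewrite (rk_inj _ _ _ _ _ Hb Hv).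
  have [_ [_ [H4 _]]] := H k kN.
  have [h4 h4'] := H4 (zip_seq d d') (zip_D Dd Dd'); split=> g.
    have [|v] := h4; first by exists a; rewrite evens_zip odds_zip.
    by rewrite evens_zip odds_zip => -[Hv]; rewrite (rk_inj _ _ _ _ _ Hb Hv).
  have [|v] := h4'; first by exists b; rewrite evens_zip odds_zip.
  by rewrite evens_zip odds_zip => -[Hv]; rewrite (rk_inj _ _ _ _ _ Hka Hv).
(* Otherwise jumps of equal rank for the same tuple are matched, and [b] realizes the image of the
   cut of [a]. *)
pose E u v := exists d k, (forall n, D (d n)) /\ ((k < N.+1)%N /\
  (rk k u d x /\ rk k v d y)).
have [|||||b Hb] := transfer_cut sc_small (E := E) (a := a).
- move=> u v [d [k [Dd [_ [[Gu _] _]]]]] ua; apply: nG; exists d; split=> //.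
  by rewrite -ua.
- move=> u v u' v' [d [k [Dd [kN [Hu Hv]]]]] [d' [k' [Dd' [kN' [Hu' Hv']]]]] uu'.
  have [_ [_ [_ [_ [_ /(_ k' kN')[_ [H5 _]]]]]]] := H k kN.
  have [|w [w' []]] := (H5 (zip_seq d d') (zip_D Dd Dd')).1.
    by exists u, u'; rewrite evens_zip odds_zip.
  rewrite evens_zip odds_zip => Hw [Hw'].
  by rewrite (rk_inj _ _ _ _ _ Hv Hw) (rk_inj _ _ _ _ _ Hv' Hw').
- move=> u v u' v' s Ds [d [k [Dd [kN [Hu Hv]]]]] [d' [k' [Dd' [kN' [Hu' Hv']]]]] uu'.
  have [_ [_ [_ [_ [_ /(_ k' kN')[_ [_ H6]]]]]]] := H k kN.
  have [|w [w' []]] := (H6 (env_cons s (zip_seq d d')) (env_cons_D Ds (zip_D Dd Dd'))).1.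
    by exists u, u'; rewrite /= evens_zip odds_zip.
  rewrite /= evens_zip odds_zip => Hw [Hw'].
  by rewrite (rk_inj _ _ _ _ _ Hv Hw) (rk_inj _ _ _ _ _ Hv' Hw').
- move=> u v s Ds [d [k [Dd [kN [Hu Hv]]]]] us.
  have [_ [_ [_ [H7 _]]]] := H k kN.
  have [|w [Hw]] := (H7 (env_cons s d) (env_cons_D Ds Dd)).1; first by exists u.
  by rewrite /= (rk_inj _ _ _ _ _ Hv Hw).
- move=> u v s Ds [d [k [Dd [kN [Hu Hv]]]]] us.
  have [_ [_ [_ [_ [H8 _]]]]] := H k kN.
  have [|w [Hw]] := (H8 (env_cons s d) (env_cons_D Ds Dd)).1; first by exists u.
  by rewrite /= (rk_inj _ _ _ _ _ Hv Hw).
exists b => d Dd.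
have match_ v : G d y v -> exists k u, [/\ rk k u d x, rk k v d y & E u v].
  move=> Gv; have [k [kN Ek]] := exN d y v; have Hv : rk k v d y by [].
  have [u Hu] := rk_trace' k d v kN Dd Hv.
  by exists k, u; split=> //; exists d, k.
have nGa : ~ G d x a by move=> Ga; apply: nG; exists d.
have cmp u : G d x u -> u < a \/ a < u.
  move=> Gu; have /eqP : u <> a by move=> ua; apply: nGa; rewrite -ua.
  by rewrite neq_lt => /orP[]; [left|right].
split; last first.
  split=> // Gb; have [k [u [[Gu _] _ /Hb[Hlt Hgt]]]] := match_ b Gb.
  by case: (cmp u Gu) => [/Hlt|/Hgt]; rewrite ltxx.
(* More than [i] jumps below [b] would give one of rank at least [i], whose partner can lie on
   neither side of [a]. Conversely the last jump below [a] has rank [i - 1], and its partner lies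
   below [b]. *)
move=> i iN Ei; split; last first.
  move=> [v [vb [Gv Hv]]]; have [k [u [[Gu Eu] [_ Ev] /Hb[Hlt Hgt]]]] := match_ v Gv.
  have ik : (i <= k)%N.
    rewrite leqNgt; apply/negP => ki; case: Ev => _; apply.
    exact: at_least_leq Hv.
  case: (cmp u Gu) => [ua|/Hgt bv].
    by have := exactly_lt Gu ua Eu Ei; rewrite ltnNge ik.
  by have := lt_trans vb bv; rewrite ltxx.
case: i iN Ei => // j jN Ei; have [[u [ua [Gu Hu]]] _] := Ei.
have [k [kN Ek]] := exN d x u.
have kj : (k <= j)%N by have := exactly_lt Gu ua Ek Ei.
have jk : (j <= k)%N.
  by rewrite leqNgt; apply/negP => kj'; case: Ek => _; apply; exact: at_least_leq Hu.
have Ekj : k = j by apply/eqP; rewrite eqn_leq kj.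
rewrite Ekj in kN Ek.
have [v Hv] := rk_trace j d u kN Dd (conj Gu Ek).
have [Hlt _] : (u < a -> v < b) /\ (a < u -> b < v).
  by apply: Hb; exists d, j; split=> //; split=> //; split.
case: Hv => Gv [Hv _]; exists v; split; first exact: Hlt.
by split.
Qed.

End BackAndForth.
End Traces.

(** * Formulas of the expansion are determined by traces *)

Section FormulaTraces.
Variables (R : realType) (L : language) (S : structure L R) (D : R -> Prop).
Let RD := expand_by_set S D.

Lemma expand_by_set_term (t : term (language_sum L unary_predicate_language)) :
  exists t' : term L, forall e, Defs.eval RD e t = Defs.eval S e t'.
Proof.
elim: t => [n|[f|[]] ts /= /choice[ts' Hts]]; first by exists (@Var L n).
exists (App ts') => e /=; congr fun_interp.
by apply: funext => i; exact: Hts.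
Qed.

Lemma defFun_eval (t : term (language_sum L unary_predicate_language)) (V : Type)
  (h : nat -> V) : defFun S (fun e => Defs.eval RD (fun k => e (h k)) t).
Proof.
have [t' Ht] := expand_by_set_term t.
exists (FEq (@Var L 0) (rename_term succn t')).
exists (fun k => if k is k'.+1 then inl (Some (h k')) else inl None) => e /=.
by rewrite Ht eval_rename.
Qed.

Lemma defPred_rel (r : rel_symbol L)
    (ts : 'I_(rel_arity r) -> term (language_sum L unary_predicate_language))
    (V : Type) (h : nat -> V) :
  defPred S (fun e => rel_interp S (fun i => Defs.eval RD (fun k => e (h k)) (ts i))).
Proof.
have /choice[ts' Hts] := fun i => expand_by_set_term (ts i).
exists (FRel ts'), (fun k => inl (h k)) => e /=.
rewrite (_ : (fun i => _) = (fun i => Defs.eval S (fun k => e (h k)) (ts' i))) //.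
by apply: funext => i; rewrite Hts.
Qed.

Hypotheses (Sf : defField S) (Somin : o_minimal S).

(** A finite [D] is a finite disjunction of equations with parameters, so adding it defines nothing
    new. *)
Lemma defPred_finite_expansion (s : seq R) (p : formula (language_sum L unary_predicate_language)) :
  (forall x, D x <-> x \in s) ->
  forall (V : Type) (h : nat -> V), defPred S (fun e => sat RD (fun k => e (h k)) p).
Proof.
move=> Ds.
have quantifier p' : (forall (V : Type) (h : nat -> V),
    defPred S (fun e => sat RD (fun k => e (h k)) p')) ->
    forall (V : Type) (h : nat -> V), defPred S (fun e : option V -> R =>
      sat RD (env_cons (e None) (fun k => e (Some (h k)))) p').
  move=> IH V h; have := IH _ (fun k => if k is k'.+1 then Some (h k') else None).
  apply: defPred_iff => e.
  rewrite (_ : (fun k => _) = env_cons (e None) (fun k => e (Some (h k)))) //.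
  by apply: funext => -[].
elim: p => [|t u|[r|[]] ts|p IHp q IHq|p IHp q IHq|p IHp q IHq|p IH|p IH] V h /=.
- exact: (defPred_false S 0).
- by apply: (defPred_eq 0); exact: defFun_eval.
- exact: defPred_rel.
- have : defPred S (fun e => exists x, x \in s /\ x = Defs.eval RD (fun k => e (h k)) (ts ord0)).
    apply: defPred_ex_seq => x; apply: (defPred_eq 0); first exact: defFun_cst.
    exact: defFun_eval.
  apply: defPred_iff => e; rewrite Ds; split=> [[x [xs <-]]|xs] //.
  by exists (Defs.eval RD (fun k => e (h k)) (ts ord0)).
- by apply: defPred_imp; [exact: IHp|exact: IHq].
- by apply: defPred_and; [exact: IHp|exact: IHq].
- by apply: defPred_or; [exact: IHp|exact: IHq].
- by apply: (defPred_all 0); exact: quantifier.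
- by apply: (defPred_ex 0); exact: quantifier.
Qed.

Variables (d0 d1 : R).
Hypotheses (Dd0 : D d0) (Dd1 : D d1) (d01 : d0 <> d1).
Variable sc : R -> R.
Hypotheses (Hsc : defRel S (fun s w => s = sc w))
  (sc_small : forall eps : R, 0 < eps -> exists w, D w /\ 0 < sc w /\ sc w < eps).

Lemma trace_bounded_sym (E : (nat -> R) -> (nat -> R) -> Prop) :
  trace_bounded S D E -> trace_bounded S D (fun x y => E x y /\ E y x).
Proof.
move=> [th [Hth HE]]; exists th; split=> // x y Hxy.
by split; apply: HE => // d Dd; rewrite Hxy.
Qed.

(** Induction on the formula: atomic formulas of [S] are traces independent of [d], and quantifiers
    are handled by back and forth. *)
Lemma trace_bounded_sat (p : formula (language_sum L unary_predicate_language)) :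
  trace_bounded S D (fun x y => sat RD x p <-> sat RD y p).
Proof.
have onedir (P : (nat -> R) -> Prop) : trace_bounded S D (fun x y => P x -> P y) ->
    trace_bounded S D (fun x y => P x <-> P y).
  by move=> /trace_bounded_sym; apply: trace_bounded_sub => x y [].
have pure (P : (nat -> R) -> Prop) : defPred S P ->
    trace_bounded S D (fun x y => P x <-> P y).
  move=> HP; exists (fun _ x => P x); split; first exact: (defPred_vars inr HP).
  by move=> x y /(_ (fun _ => d0)); apply.
have connective E1 E2 E3 : (forall x y : nat -> R, E1 x y -> E2 x y -> E3 x y) ->
    trace_bounded S D E1 -> trace_bounded S D E2 -> trace_bounded S D E3.
  move=> H H1 H2; have := trace_bounded_and Dd0 Dd1 d01 H1 H2.
  by apply: trace_bounded_sub => x y [] /H.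
have quantifier p' : trace_bounded S D (fun x y => sat RD x p' <-> sat RD y p') ->
    trace_bounded S D (fun x y => forall a, exists b,
      sat RD (env_cons a x) p' <-> sat RD (env_cons b y) p').
  move=> [th [Hth HE]].
  have := trace_bounded_back_and_forth Sf Somin Dd0 Dd1 d01 Hsc sc_small Hth.
  by apply: trace_bounded_sub => x y H a; have [b Hb] := H a; exists b; exact: HE.
elim: p => [|t u|[r|[]] ts|p IHp q IHq|p IHp q IHq|p IHp q IHq|p IH|p IH] /=.
- by apply: pure; exact: (defPred_false S 0).
- by apply: pure; apply: (defPred_eq 0); exact: (defFun_eval _ id).
- by apply: pure; exact: (defPred_rel _ id).
(* The value of a term lies in [D] exactly when it equals an entry of some sequence in [D]. *)
- apply: onedir; exists (fun d x => d 0%N = Defs.eval RD x (ts ord0)); split.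
    by apply: (defPred_eq 0); [exact: defFun_var|exact: (defFun_eval _ inr)].
  by move=> x y H Dx; have [/(_ erefl) <- _] := H (fun _ => _) (fun _ => Dx).
- by apply: connective IHp IHq => x y -> ->.
- by apply: connective IHp IHq => x y -> ->.
- by apply: connective IHp IHq => x y -> ->.
- apply: onedir; have := trace_bounded_sym (quantifier p IH).
  by apply: trace_bounded_sub => x y [_ H] Hx b; have [a Ha] := H b; apply/Ha.
- apply: onedir; have := quantifier p IH.
  by apply: trace_bounded_sub => x y H [a Ha]; have [b Hb] := H a; exists b; apply/Hb.
Qed.

End FormulaTraces.

(** * Small scales from infinite sets, and stratification of discrete sets *)

Section DiscreteSets.
Variable R : realType.

Lemma accumulation_point (A : set R) (t : R) : (forall x, A x -> `|x| <= t) ->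
  infinite_set A -> exists p, forall eta : R, 0 < eta ->
    exists y, A y /\ (0 < `|y - p| /\ `|y - p| < eta).
Proof.
move=> At Ainf.
have [|p Hp] := infinite_bounded_limit_point_nonempty Ainf.
  exists t; split; first exact: num_real.
  by move=> M tM x Ax /=; apply: le_trans (ltW tM); exact: At.
exists p => eta eta0; have [y [yp Ay]] := Hp _ (nbhsx_ballx p eta eta0).
rewrite -ball_normE /= => py; exists y; split=> //.
by rewrite normr_gt0 subr_eq0 distrC.
Qed.

Definition has_scale (L : language) (S : structure L R) (D : R -> Prop) : Prop :=
  exists sc : R -> R, defRel S (fun s w => s = sc w) /\
    forall eps : R, 0 < eps -> exists w, D w /\ 0 < sc w /\ sc w < eps.

(** If [D] is bounded, the distances to an accumulation point are arbitrarily small; otherwise the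
    inverses of [1 + |w|] are. *)
Lemma infinite_has_scale (L : language) (S : structure L R) (D : set R) :
  defField S -> infinite_set D -> has_scale S D.
Proof.
move=> Sf Dinf; have [[t Ht]|unb] := pselect (exists t, forall x, D x -> `|x| <= t).
  have [p Hp] := accumulation_point Ht Dinf.
  exists (fun w => `|w - p|); split; first by rewrite /defRel; def_auto.
  by move=> eps /Hp[y [Dy [y0 ye]]]; exists y.
exists (fun w => (1 + `|w|)^-1); split.
  apply: (@defPred_iff _ _ _ _ (fun e : bool -> R => e true * (1 + `|e false|) = 1)).
    move=> e; have n0 : 1 + `|e false| != 0.
      by rewrite gt_eqF //; have := normr_ge0 (e false); lra.
    split=> [H|->]; last by rewrite mulVf.
    by apply: (mulIf n0); rewrite H mulVf.
  by def_auto.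
move=> eps eps0; have [w Dw we] : exists2 w, D w & eps^-1 < `|w|.
  apply: contrapT => H; apply: unb; exists (eps^-1) => x Dx.
  by rewrite leNgt; apply/negP => h; apply: H; exists x.
have w0 : 0 < 1 + `|w| by have := normr_ge0 w; lra.
exists w; split=> //; rewrite invr_gt0; split=> //.
by rewrite -[eps]invrK ltf_pV2 ?posrE ?invr_gt0 //; lra.
Qed.

Variable D : set R.

(** For [t > 0]: the points of [D] in [-t, t] at distance at least [1 / t] from the rest of [D].
    These sets increase with [t] and exhaust a discrete [D]. *)
Definition separated_by (t d : R) : Prop :=
  D d /\ (`|d| <= t /\ forall d', D d' -> d' <> d -> 1 <= `|d - d'| * t).

(** An accumulation point would yield two points closer than [1 / t]. *)
Lemma finite_separated_by t : finite_set [set d | separated_by t d].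
Proof.
apply: contrapT => inf.
have [|p Hp] := accumulation_point (t := t) _ inf; first by move=> x [_ []].
have [t0|t0] := leP t 0.
  have [y [[Dy [_ Hy]] [y0 y1]]] := Hp 1 ltr01.
  have [z [[Dz _] [z0 z1]]] := Hp _ y0.
  have : 1 <= `|y - z| * t by apply: Hy => // zy; move: z1; rewrite zy ltxx.
  have : `|y - z| * t <= 0 by apply: mulr_ge0_le0.
  lra.
have t20 : 0 < 1 / (2 * t) by apply: divr_gt0; lra.
have [y [[Dy [_ Hy]] [y0 y1]]] := Hp _ t20.
have [z [[Dz _] [z0 z1]]] := Hp _ y0.
have : 1 <= `|y - z| * t by apply: Hy => // zy; move: z1; rewrite zy ltxx.
have yz : `|y - z| < 2 * (1 / (2 * t)).
  by have := ler_distD p y z; rewrite (distrC p z); lra.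
have : `|y - z| * t < 2 * (1 / (2 * t)) * t by rewrite ltr_pM2r.
have -> : 2 * (1 / (2 * t)) * t = 1 by field; rewrite gt_eqF.
lra.
Qed.

Lemma separated_by_le t t' d : t <= t' -> separated_by t d -> separated_by t' d.
Proof.
move=> tt' [Dd [dt Hd]]; split=> //; split; first exact: le_trans tt'.
move=> d' Dd' dd'; apply: le_trans (Hd d' Dd' dd') _.
by apply: ler_wpM2l.
Qed.

Lemma separated_by_exists d : discrete_subset D -> D d -> exists t, separated_by t d.
Proof.
move=> Ddisc Dd; have [_ [V Vd VD]] := Ddisc d Dd.
have [eta /= eta0 Veta] := (nbhs_ballP d V).1 Vd.
exists (Num.max `|d| eta^-1); split=> //; split; first by rewrite le_max lexx.
move=> d' Dd' dd'.
have far : eta <= `|d - d'|.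
  rewrite leNgt; apply/negP => h; apply: dd'.
  have : (V `&` D) d' by split=> //; apply: Veta; rewrite -ball_normE.
  by rewrite VD.
rewrite -(mulfV (lt0r_neq0 eta0)); apply: ler_pM => //.
- exact: ltW.
- by rewrite invr_ge0 ltW.
- by rewrite le_max lexx orbT.
Qed.

Variable dflt : R.

(* Quantification over the m-tuples of elements of D separated by t, padded into
   sequences by dflt. *)
Fixpoint ex_tuple (m : nat) (t : R) (P : (nat -> R) -> Prop) : Prop :=
  if m is k.+1 then
    exists a, separated_by t a /\ ex_tuple k t (fun d => P (env_cons a d))
  else P (fun _ => dflt).

Lemma ex_tuple_le m t t' P : t <= t' -> ex_tuple m t P -> ex_tuple m t' P.
Proof.
elim: m P => //= m IH P tt' [a [Ha HP]]; exists a; split; last exact: IH.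
exact: separated_by_le Ha.
Qed.

Lemma ex_tupleI m (d : nat -> R) (P : (nat -> R) -> Prop) :
  discrete_subset D -> (forall n, D (d n)) ->
  P (fun n => if (n < m)%N then d n else dflt) -> exists t, ex_tuple m t P.
Proof.
move=> Ddisc; elim: m d P => [|m IH] d P Dd HP; first by exists 0.
have [|t Ht] := IH (fun n => d n.+1) (fun d' => P (env_cons (d 0%N) d')) (fun n => Dd n.+1).
  rewrite (_ : env_cons _ _ = (fun n => if (n < m.+1)%N then d n else dflt)) //.
  by apply: funext => -[].
have [t' Ht'] := separated_by_exists Ddisc (Dd 0%N).
exists (Num.max t t'); exists (d 0%N); split.
  by apply: separated_by_le Ht'; rewrite le_max lexx orbT.
by apply: ex_tuple_le Ht; rewrite le_max lexx.
Qed.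

Lemma finite_ex_tuple m t (J : (nat -> R) -> R -> Prop) :
  (forall d, finite_set [set v | J d v]) ->
  finite_set [set v | ex_tuple m t (fun d => J d v)].
Proof.
elim: m J => [|m IH] J HJ /=; first exact: HJ.
apply: (@sub_finite_set _ _ (\bigcup_(a in [set a | separated_by t a])
   [set v | ex_tuple m t (fun d => J (env_cons a d) v)])).
  by move=> v [a [Ha Hv]]; exists a.
by apply: bigcup_finite => [|a _]; [exact: finite_separated_by|apply: IH].
Qed.

Lemma defPred_ex_tuple (L : language) (S : structure L R) m (V : Type)
    (P : (nat -> R) -> (V -> R) -> Prop) (f : (V -> R) -> R) :
  defField S -> defSet S D ->
  defPred S (fun e : nat + V -> R => P (fun n => e (inl n)) (fun i => e (inr i))) ->
  defFun S f -> defPred S (fun e => ex_tuple m (f e) (fun d => P d e)).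
Proof.
move=> Sf HD; have Hsep : defRel S (separated_by).
  by rewrite /defRel /separated_by; def_auto.
elim: m V P f => [|m IH] V P f HP Hf /=.
  apply: (defPred_proj (h := fun (e : V -> R) o => match o with
    | inl n => dflt | inr i => e i end)) HP.
  by move=> [n|i]; [right; exists dflt|left; exists i].
apply: (defPred_ex 0); apply: defPred_and; first by def_auto.
have := IH (option V) (fun d e => P (env_cons (e None) d) (fun i => e (Some i)))
  (fun e => f (fun i => e (Some i))) _ (defFun_vars Some Hf); apply.
apply: (defPred_proj (h := fun (e : nat + option V -> R) o => match o with
  | inl 0%N => e (inr None) | inl n.+1 => e (inl n) | inr i => e (inr (Some i)) end)) HP.
by move=> [[|n]|i]; left; [exists (inr None)|exists (inl n)|exists (inr (Some i))].
Qed.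

End DiscreteSets.

(** * The dichotomy *)

(** An interval inside the closure of [A] contains one where [A] is constant; that one meets [A],
    hence lies in [A]. *)
Lemma interior_or_nowhere_dense (R : realType) (A : set R) :
  (forall u v : R, u < v -> exists u' v', [/\ u <= u', u' < v', v' <= v &
    forall x y, u' < x -> x < v' -> u' < y -> y < v' -> A x -> A y]) ->
  interior A !=set0 \/ nowhere_dense A.
Proof.
move=> H; have [nd|nd] := pselect (nowhere_dense A); first by right.
left; have /set0P[x Ax] : interior (closure A) != set0 by apply/eqP.
have [eta /= eta0 Heta] := (nbhs_ballP x (closure A)).1 Ax.
have [|u [v [u1 uv v1 Huv]]] := H (x - eta) (x + eta); first lra.
pose m := (u + v) / 2; pose w := (v - u) / 2.
have w0 : 0 < w by rewrite /w; lra.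
have ballP y : ball m w y <-> u < y /\ y < v.
  rewrite -ball_normE /= distrC ltr_distl /m /w.
  by split=> [/andP[]|[]] *; [split; lra|apply/andP; split; lra].
have : closure A m.
  by apply: Heta; rewrite -ball_normE /= distrC ltr_distl /m; apply/andP; split; lra.
move=> /(_ _ (nbhsx_ballx m w w0))[z [Az /ballP[z1 z2]]].
exists m; apply/nbhs_ballP; exists w => // y /ballP[y1 y2].
exact: Huv Az.
Qed.

Lemma finite_jumps_dichotomy (R : realType) (A : set R) :
  finite_set [set u | jump A u] -> interior A !=set0 \/ nowhere_dense A.
Proof.
move=> /finite_set_countable Ajump; apply: interior_or_nowhere_dense => u v uv.
have [x [ux [xv /not_jump[eta eta0 Heta]]]] := interval_escapes_countable Ajump uv.
exists (Num.max u (x - eta)), (Num.min v (x + eta)); split.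
- by rewrite le_max lexx.
- by rewrite gt_max !lt_min; apply/andP; split; apply/andP; split; lra.
- by rewrite ge_min lexx.
move=> y z; rewrite !gt_max !lt_min.
move=> /andP[_ y1] /andP[_ y2] /andP[_ z1] /andP[_ z2].
by rewrite (Heta y) ?(Heta z) // ltr_distl ?z1 ?z2 ?y1 ?y2.
Qed.

Section DiscreteExpansion.
Variables (R : realType) (L : language) (S : structure L R) (D : set R).
Hypotheses (Sf : defField S) (Somin : o_minimal S) (Ddisc : discrete_subset D).
Let RD := expand_by_set S D.

Lemma defField_expand_by_set : defField RD.
Proof. exact: defField_inl. Qed.

Lemma defSet_predicate : defSet RD D.
Proof.
exists (@FRel (language_sum L unary_predicate_language) (inr tt) (fun _ => @Var _ 0)).
by exists (fun _ => inl tt) => e.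
Qed.

Section TraceJumps.
Variable theta : (nat -> R) -> (nat -> R) -> Prop.
Hypothesis Htheta : defTrace S theta.
Variables (e0 : nat -> R) (dflt : R).

Let Q d a := theta d (env_cons a e0).

Let HQ (V : Type) (f : (V -> R) -> R) (g : nat -> V) :
  defFun RD f -> defPred RD (fun e => Q (fun n => e (g n)) (f e)).
Proof.
move=> Hf; apply: (@defPred_iff _ _ _ _ (fun e => exists a, a = f e /\
    Q (fun n => e (g n)) a)).
  by move=> e; split=> [[a [->]]|] //; exists (f e).
apply: (defPred_ex 0); apply: defPred_and; first exact: Hf.
apply: (defPred_proj (h := fun (e : option V -> R) o => match o with
  | inl n => e (Some (g n)) | inr n => env_cons (e None) e0 n end)
  _ (defPred_inl _ Htheta)).
by move=> [n|[|n]]; [left; exists (Some (g n))|left; exists None|right; exists (e0 n)].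
Qed.

Let Qjumps d : finite_set [set v | jump (Q d) v].
Proof.
apply: (finite_jumps Somin).
apply: (defPred_proj (h := fun (e : unit -> R) o => match o with
  | inl n => d n | inr n => env_cons (e tt) e0 n end) _ Htheta).
by move=> [n|[|n]]; [right; exists (d n)|left; exists tt|right; exists (e0 n)].
Qed.

(** Reduces sequences in [D] to [m]-tuples, over which quantification is first-order. *)
Let Qsupport : exists m, forall d, Q d = Q (fun n => if (n < m)%N then d n else dflt).
Proof.
have HQn : defPred RD (fun e : nat -> R => Q (fun n => e n.+1) (e 0%N)).
  by apply: HQ; exact: defFun_var.
have [B HB] := defPred_finite_support HQn.
exists B => d; apply: funext => a; apply: propext.
apply: (HB (env_cons a d) (env_cons a (fun n => if (n < B)%N then d n else dflt))).
by move=> [|k] //= kB; rewrite (ltnW kB).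
Qed.

Lemma jumps_define_int_or_nowhere_dense :
  definable RD (range (fun z : int => z%:~R)) \/
  forall u v : R, u < v -> exists u' v', [/\ u <= u', u' < v', v' <= v &
    forall w d, u' < w -> w < v' -> (forall n, D (d n)) -> ~ jump (Q d) w].
Proof.
have [m Hm] := Qsupport.
(* The sets [T t] are finite, increase with [t] and have union [F]; [B] is the preorder of first
   appearance. This is the stratification needed for coding when [F] is dense in an interval. *)
pose T t v := ex_tuple D dflt m t (fun d => jump (Q d) v).
pose F v := exists t, T t v.
pose B w v := forall t, T t v -> T t w.
have HT : defRel RD T.
  apply: (defPred_ex_tuple dflt m (P := fun d (e : bool -> R) => jump (Q d) (e false))).
  - exact: defField_expand_by_set.
  - exact: defSet_predicate.
  - have RDf := defField_expand_by_set.
    by rewrite /jump; repeat first [def_step | apply: HQ].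
  - exact: defFun_var.
have [[alpha [beta [ab dense]]]|ndense] := pselect (exists alpha beta, alpha < beta /\
    forall x eta : R, alpha < x -> x < beta -> 0 < eta ->
      exists2 v, F v & `|v - x| < eta).
  left; apply: (dense_stratified_defines_int (F := F) (B := B)) ab dense.
  - exact: defField_expand_by_set.
  - by rewrite /defSet /F; def_auto.
  - by rewrite /defRel /B; def_auto.
  - by move=> v _ t.
  - by move=> u v w uv vw t /vw/uv.
  - move=> u v _ _; have [|] := pselect (B u v); first by left.
    move=> /existsNP[t /not_implyP[Tv nTu]]; right=> t' Tu.
    apply: ex_tuple_le Tv; rewrite leNgt; apply/negP => /ltW t't.
    by apply: nTu; exact: ex_tuple_le Tu.
  - move=> v [t Tv]; apply: (@sub_finite_set _ _ [set w | T t w]).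
      by move=> w [_ /(_ t Tv)].
    exact: finite_ex_tuple Qjumps.
right=> u v uv.
have [x [eta [ux xv eta0 Hx]]] : exists x eta : R, [/\ u < x, x < v, 0 < eta &
    forall w, F w -> eta <= `|w - x|].
  apply: contrapT => H; apply: ndense; exists u, v; split=> // x eta ux xv eta0.
  apply: contrapT => H'; apply: H; exists x, eta; split=> // w Fw.
  by rewrite leNgt; apply/negP => h; apply: H'; exists w.
exists (Num.max u (x - eta)), (Num.min v (x + eta)); split.
- by rewrite le_max lexx.
- by rewrite gt_max !lt_min; apply/andP; split; apply/andP; split; lra.
- by rewrite ge_min lexx.
move=> w d; rewrite gt_max lt_min => /andP[_ w1] /andP[_ w2] Dd jw.
have /Hx : F w.
  have [t Ht] : exists t, ex_tuple D dflt m t (fun d => jump (Q d) w).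
    by apply: ex_tupleI Ddisc Dd _; rewrite -Hm.
  by exists t.
by rewrite leNgt => /negP; apply; rewrite ltr_distl w1 w2.
Qed.

End TraceJumps.

Lemma discrete_expansion_dichotomy (A : set R) : definable RD A ->
  definable RD (range (fun z : int => z%:~R)) \/
  (interior A !=set0 \/ nowhere_dense A).
Proof.
move=> [p [e0 HA]]; have [Dfin|Dinf] := pselect (finite_set D).
  right; apply: finite_jumps_dichotomy; apply: (finite_jumps Somin).
  have [s Ds] := (finite_seqP _).1 Dfin.
  have Hp : defPred S (fun e : nat -> R => sat RD e p).
    by apply: (@defPred_finite_expansion _ _ _ _ s) (fun k => k) => x; rewrite Ds.
  rewrite HA; apply: (defPred_proj (h := fun e : unit -> R => env_cons (e tt) e0) _ Hp).
  by move=> [|k]; [left; exists tt|right; exists (e0 k)].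
have [sc [Hsc sc_small]] := infinite_has_scale Sf Dinf.
have [d0 [Dd0 _]] := sc_small 1 ltr01.
have [d1 Dd1 d01] : exists2 d1, D d1 & d0 <> d1.
  apply: contrapT => H; apply: Dinf; apply: (@sub_finite_set _ _ [set d0]).
    by move=> d Dd; apply: contrapT => dd0; apply: H; exists d => // E; apply: dd0.
  exact: finite_set1.
have [th [Hth HE]] := trace_bounded_sat Sf Somin Dd0 Dd1 d01 Hsc sc_small p.
have [|gaps] := jumps_define_int_or_nowhere_dense Hth e0 d0; first by left.
right; apply: interior_or_nowhere_dense => u v /gaps[u' [v' [uu' uv' v'v nj]]].
exists u', v'; split=> // x y x1 x2 y1 y2.
rewrite HA /=; apply: (HE _ _ _).1 => d Dd.
(* Without jumps, [th d] is constant on the interval for every [d] in [D], so [x] and [y] have the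
   same trace. *)
pose P a := th d (env_cons a e0).
have const a b : a <= b -> u' < a -> b < v' -> P a <-> P b.
  move=> ab a1 b2; apply: no_jump_const => // w aw wb; apply: nj => //.
    exact: lt_le_trans aw.
  exact: le_lt_trans wb _.
by have [xy|/ltW yx] := leP x y; [exact: const|apply: iff_sym; exact: const].
Qed.

End DiscreteExpansion.

Theorem theoremE (R : realType) (L : language) (N : structure L R) (D : set R) :
  o_minimal (expansion (ordered_field R) N) ->
  discrete_subset D ->
  let RD := expand_by_set (expansion (ordered_field R) N) D in
  definable RD (range (fun z : int => z%:~R)) \/
  (forall A : set R, definable RD A -> interior A !=set0 \/ nowhere_dense A).
Proof.
move=> omin Ddisc RD.
have [|nZ] := pselect (definable RD (range (fun z : int => z%:~R))); first by left.
right=> A; have Sf := defField_expansion N.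
by case/(discrete_expansion_dichotomy Sf omin Ddisc).
Qed.
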